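(* Let $\widehat{a}_1,\dots,\widehat{a}_p,\widehat{b}_1,\dots,\widehat{b}_q$ ($p,q\ge1$) and $\widehat{x}$ be dual numbers such that $\Re(\widehat{a}_1)>0$, $\Re(\widehat{b}_1)>0$ and $\Re(\widehat{b}_1-\widehat{a}_1)>0$. Then the generalized dual hypergeometric function ${}_pF_q(\widehat{a}_1,\dots,\widehat{a}_p;\widehat{b}_1,\dots,\widehat{b}_q;\widehat{x})$ can be represented in each of the following integral forms, where $b$ in the third is a real parameter: $$\frac{\Gamma_d(\widehat{b}_1)}{\Gamma_d(\widehat{a}_1)\,\Gamma_d(\widehat{b}_1-\widehat{a}_1)}\int_0^1u^{\widehat{a}_1-1}(1-u)^{\widehat{b}_1-\widehat{a}_1-1}\,{}_{p-1}F_{q-1}(\widehat{a}_2,\dots,\widehat{a}_p;\widehat{b}_2,\dots,\widehat{b}_q;u\,\widehat{x})\,du;$$ $$\frac{\Gamma_d(\widehat{b}_1)}{\Gamma_d(\widehat{a}_1)\,\Gamma_d(\widehat{b}_1-\widehat{a}_1)}\int_0^\infty u^{\widehat{a}_1-1}(1+u)^{-\widehat{a}_1-\widehat{b}_1}\,{}_{p-1}F_{q-1}\Bigl(\widehat{a}_2,\dots,\widehat{a}_p;\widehat{b}_2,\dots,\widehat{b}_q;\frac{u}{1+u}\widehat{x}\Bigr)\,du;$$ $$\frac{\Gamma_d(\widehat{b}_1)}{\Gamma_d(\widehat{a}_1)\,\Gamma_d(\widehat{b}_1-\widehat{a}_1)}\,b^{\widehat{a}_1}\int_0^\infty u^{\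widehat{a}_1-1}(1+bu)^{-\widehat{a}_1-\widehat{b}_1}\,{}_{p-1}F_{q-1}\Bigl(\widehat{a}_2,\dots,\widehat{a}_p;\widehat{b}_2,\dots,\widehat{b}_q;\frac{bu}{1+bu}\widehat{x}\Bigr)\,du.$$
   Context: Dual numbers are $\widehat{x}=x_1+\varepsilon x_2$ with $x_1,x_2\in\mathbb{R}$ and $\varepsilon^2=0$, added and multiplied accordingly; $\Re(\widehat{x})=x_1$ is the real part, and division by $\widehat{x}$ is defined when $x_1\ne0$. For real $t>0$, $t^{c+\varepsilon d}=t^c(1+\varepsilon d\log t)$. The dual gamma function is $\Gamma_d(c+\varepsilon d)=\int_0^\infty e^{-t}t^{c+\varepsilon d-1}\,dt=\Gamma(c)+\varepsilon d\,\Gamma'(c)$. The dual shifted factorial is $(\widehat{a})_0=1$ and $(\widehat{a})_k=\widehat{a}(\widehat{a}+1)\cdots(\widehat{a}+k-1)$ for $k\ge1$, and the generalized dual hypergeometric function is $${}_pF_q(\widehat{a}_1,\dots,\widehat{a}_p;\widehat{b}_1,\dots,\widehat{b}_q;\widehat{x})=\sum_{k=0}^\infty\frac{(\widehat{a}_1)_k\cdots(\widehat{a}_p)_k}{(\widehat{b}_1)_k\cdots(\widehat{b}_q)_k}\,\frac{(\widehat{x})^k}{k!}.$$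
   Formalization: The exponent −a1−b1 of 1+u and 1+bu in the second and third integrals is corrected to −b1 (as printed they fail: p=q=1, a1=1, b1=2, x=0 gives 1=1/2); b is taken positive, and pFq is assumed to be defined (convergent, no zero denominators) at x. *)

(* Defs.v *)
From Stdlib Require Import Reals List Factorial.
From Coquelicot Require Import Coquelicot.
Open Scope R_scope.

(* The pair (x1, x2) stands for x1 + eps x2 with eps^2 = 0.  Being a product of
   copies of R, [dual] inherits Coquelicot's product normed module over R, in
   which series and integrals converge componentwise. *)
Definition dual : Type := (R * R)%type.

Definition dual_NormedModule : NormedModule R_AbsRing :=
  prod_NormedModule R_AbsRing R_NormedModule R_NormedModule.

Definition dRe (x : dual) : R := fst x.
Definition dDu (x : dual) : R := snd x.

Definition RtoD (r : R) : dual := (r, 0).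

Definition dadd (x y : dual) : dual := (dRe x + dRe y, dDu x + dDu y).
Definition dopp (x : dual) : dual := (- dRe x, - dDu x).
Definition dsub (x y : dual) : dual := dadd x (dopp y).
Definition dmul (x y : dual) : dual :=
  (dRe x * dRe y, dRe x * dDu y + dDu x * dRe y).

(* 1 / (x1 + eps x2) = 1 / x1 - eps x2 / x1^2; meaningful only if x1 <> 0. *)
Definition dinv (x : dual) : dual := (/ dRe x, - (dDu x / (dRe x) ^ 2)).
Definition ddiv (x y : dual) : dual := dmul x (dinv y).

Declare Scope dual_scope.
Delimit Scope dual_scope with D.
Bind Scope dual_scope with dual.
Infix "+" := dadd : dual_scope.
Infix "-" := dsub : dual_scope.
Notation "- x" := (dopp x) : dual_scope.
Infix "*" := dmul : dual_scope.
Infix "/" := ddiv : dual_scope.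

Fixpoint dpow (x : dual) (n : nat) : dual :=
  match n with
  | O => RtoD 1
  | S m => (x * dpow x m)%D
  end.

(* t^(c + eps d) = t^c (1 + eps d log t); meaningful only if t > 0. *)
Definition Rdpower (t : R) (c : dual) : dual :=
  (Rpower t (dRe c), Rpower t (dRe c) * (dDu c * ln t)).

Definition dgamma_integrand (a : dual) (t : R) : dual :=
  (RtoD (exp (- t)) * Rdpower t (a - RtoD 1))%D.

(* Componentwise because Coquelicot's total operator [RInt_gen] wants a
   complete normed module and the product has no such instance. *)
Definition dGamma (a : dual) : dual :=
  (RInt_gen (fun t => dRe (dgamma_integrand a t)) (at_right 0) (Rbar_locally p_infty),
   RInt_gen (fun t => dDu (dgamma_integrand a t)) (at_right 0) (Rbar_locally p_infty)).

Fixpoint dpoch (a : dual) (k : nat) : dual :=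
  match k with
  | O => RtoD 1
  | S m => (dpoch a m * (a + RtoD (INR m)))%D
  end.

Definition dpoch_prod (s : list dual) (k : nat) : dual :=
  fold_right (fun a r => (dpoch a k * r)%D) (RtoD 1) s.

Definition dhyp_term (a b : list dual) (x : dual) (k : nat) : dual :=
  (dpoch_prod a k / dpoch_prod b k * (dpow x k / RtoD (INR (fact k))))%D.

(* The hypergeometric series is defined at x: every quotient in it is a legal
   division of dual numbers (no b_j has real part 0, -1, -2, ...), and the
   series converges. *)
Definition dhyp_defined (a b : list dual) (x : dual) : Prop :=
  (forall c, In c b -> forall n : nat, dRe c <> - INR n) /\
  ex_series (V := dual_NormedModule) (dhyp_term a b x).

(* The sum of the series; meaningful only under [dhyp_defined]. *)
Definition dhyp (a b : list dual) (x : dual) : dual :=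
  (Series (fun k => dRe (dhyp_term a b x k)),
   Series (fun k => dDu (dhyp_term a b x k))).

(* Improper Riemann integrals of dual-valued functions. *)
Definition is_dRInt_0_1 (f : R -> dual) (v : dual) : Prop :=
  is_RInt_gen (V := dual_NormedModule) f (at_right 0) (at_left 1) v.

Definition is_dRInt_0_infty (f : R -> dual) (v : dual) : Prop :=
  is_RInt_gen (V := dual_NormedModule) f (at_right 0) (Rbar_locally p_infty) v.

(* Main.v *)
Require Import Defs.
From Stdlib Require Import Reals List Lra Lia Factorial.
From Coquelicot Require Import Coquelicot.
Open Scope R_scope.

(** Write [c] for [b1 - a1], [T k] for the terms of the series at [x] and [D k]
    for those of the series without [a1] and [b1], so that
    [D k = T k * (b1)_k / (a1)_k].  Since [(a1)_k / (b1)_k = B(a1 + k, c) / B(a1, c)],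
    integrating [u^(a1-1) (1-u)^(c-1) sum D_k u^k] term by term gives
    [B(a1, c) sum T_k].  The series is only assumed to converge at [x], possibly
    conditionally and with [x] on the circle of convergence, so this exchange is
    an Abelian theorem and needs an argument.

    Summation by parts makes it explicit.  With [tail k] the remainder
    [sum_(j >= k) T j] and
    [phi k = tail (k+1) * (b1)_k / ((a1)_k (a1 + k))], [Phi] its power series,
    [[ tail 0 * B_s(a1, c) - s^a1 (1 - s)^c Phi(s) ]]
    is a primitive of the integrand, where [B_s] is the incomplete beta integral:
    comparing coefficients, this is the telescoping relation
    [tail k - tail (k+1) = T k] ([inner_series], [kernel_primitive]).  It remains to
    see that [(1 - s)^c Phi(s)] tends to 0 at 1 ([dlim_phi_1]).  Because
    [(b1)_k / (a1)_k] grows like [(k+1)^c], the terms are of the order of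
    [tail (k+1) * ((k+1) (1-s))^c s^k / (k+1)]; the logarithm in the dual part of the
    power costs [((k+1) (1-s))^(+-d)], and the binomial series
    [(1 - s)^(-p) = sum (p)_k / k! s^k] bounds the sums without the factor
    [tail], which tends to 0 ([abel_null]).  The same estimates give the
    convergence of the inner series inside the disk.

    The value [B(a, c) = Gamma a Gamma c / Gamma (a + c)] is needed for dual
    parameters, hence together with its derivatives in [a] and [c].  Integration
    by parts gives [(a + c) B(a + 1, c) = a B(a, c)], and [u = e^(-t/n)] gives
    [n^c B(a + n, c) -> Gamma c] ([is_dbeta_scaled]).  Together they yield Euler's
    limit formula for [Gamma], then the growth of [(a + c)_k / (a)_k]
    ([dlim_dpoch_ratio]) and the value of [B] ([dbeta_dGamma]); the same recursion
    carries the existence of [B(a + n, c)] for large [n] down to [B(a, c)].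

    The forms over the half-line follow by the chain rule applied to the
    primitive at [beta u / (1 + beta u)]. *)

(** * Algebra of dual numbers *)

Lemma dual_ext (x y : dual) : dRe x = dRe y -> dDu x = dDu y -> x = y.
Proof. destruct x, y; cbn; intros -> ->; reflexivity. Qed.

Ltac dual_calc :=
  intros; apply dual_ext;
  unfold ddiv, dsub, dinv, dmul, dadd, dopp, RtoD, dRe, dDu; cbn [fst snd].

Lemma dual_ring_theory :
  ring_theory (RtoD 0) (RtoD 1) dadd dmul dsub dopp (@eq dual).
Proof. constructor; dual_calc; ring. Qed.
Add Ring dual_ring : dual_ring_theory.

Lemma RtoD_add r s : RtoD (r + s) = (RtoD r + RtoD s)%D.
Proof. dual_calc; ring. Qed.
Lemma RtoD_sub r s : RtoD (r - s) = (RtoD r - RtoD s)%D.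
Proof. dual_calc; ring. Qed.
Lemma RtoD_opp r : RtoD (- r) = (- RtoD r)%D.
Proof. dual_calc; ring. Qed.
Lemma RtoD_mul r s : RtoD (r * s) = (RtoD r * RtoD s)%D.
Proof. dual_calc; ring. Qed.
Lemma dmul_RtoD r z : (RtoD r * z)%D = (r * dRe z, r * dDu z).
Proof. dual_calc; ring. Qed.

Lemma dinv_r x : dRe x <> 0 -> (x * dinv x)%D = RtoD 1.
Proof. dual_calc; field; assumption. Qed.

Lemma dmul_cancel_l x y z : dRe x <> 0 -> (x * y = x * z)%D -> y = z.
Proof.
  intros Hx H.
  transitivity (dinv x * (x * y))%D; [|rewrite H].
  - transitivity ((x * dinv x) * y)%D; [|ring]. rewrite dinv_r by easy; ring.
  - transitivity ((x * dinv x) * z)%D; [ring|]. rewrite dinv_r by easy; ring.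
Qed.

Lemma ddiv_eq x y z : dRe y <> 0 -> x = (z * y)%D -> (x / y)%D = z.
Proof.
  intros Hy ->. unfold ddiv. transitivity (z * (y * dinv y))%D; [ring|].
  rewrite dinv_r by easy; ring.
Qed.

Lemma dmul_div x y : dRe y <> 0 -> (y * (x / y))%D = x.
Proof.
  intros Hy. unfold ddiv. transitivity (x * (y * dinv y))%D; [ring|].
  rewrite dinv_r by easy; ring.
Qed.

Lemma dRe_mul x y : dRe (x * y)%D = dRe x * dRe y.
Proof. reflexivity. Qed.

(** A submultiplicative norm for which the two components of a dual number
    need not be estimated separately. *)
Definition dabs (x : dual) : R := Rabs (dRe x) + Rabs (dDu x).

Lemma dabs_pos x : 0 <= dabs x.
Proof. unfold dabs. pose proof (Rabs_pos (dRe x)). pose proof (Rabs_pos (dDu x)). lra. Qed.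

Lemma dabs_Re x : Rabs (dRe x) <= dabs x.
Proof. unfold dabs. pose proof (Rabs_pos (dDu x)). lra. Qed.

Lemma dabs_Du x : Rabs (dDu x) <= dabs x.
Proof. unfold dabs. pose proof (Rabs_pos (dRe x)). lra. Qed.

Lemma dabs_mul x y : dabs (x * y) <= dabs x * dabs y.
Proof.
  unfold dabs, dmul, dRe, dDu; cbn [fst snd].
  pose proof (Rabs_triang (fst x * snd y) (snd x * fst y)) as H.
  rewrite !Rabs_mult in *.
  pose proof (Rmult_le_pos _ _ (Rabs_pos (snd x)) (Rabs_pos (snd y))). nra.
Qed.

Lemma dabs_add x y : dabs (x + y) <= dabs x + dabs y.
Proof.
  unfold dabs, dadd, dRe, dDu; cbn [fst snd].
  pose proof (Rabs_triang (fst x) (fst y)). pose proof (Rabs_triang (snd x) (snd y)). lra.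
Qed.

Lemma dabs_RtoD r : dabs (RtoD r) = Rabs r.
Proof. unfold dabs, RtoD, dRe, dDu; cbn [fst snd]. rewrite Rabs_R0. ring. Qed.

Lemma dabs_mul_RtoD r x : dabs (RtoD r * x) = Rabs r * dabs x.
Proof.
  rewrite dmul_RtoD. unfold dabs, dRe, dDu; cbn [fst snd].
  rewrite !Rabs_mult. ring.
Qed.

(** The exponential series at a dual argument; it makes the powers [t^c] of a
    positive real [t] obey the law of exponents by a single ring identity. *)
Definition dexp (z : dual) : dual := (exp (dRe z), exp (dRe z) * dDu z).

Lemma dexp_add z w : dexp (z + w) = (dexp z * dexp w)%D.
Proof. unfold dexp; dual_calc; rewrite exp_plus; ring. Qed.

Lemma dexp_0 : dexp (RtoD 0) = RtoD 1.
Proof. unfold dexp; dual_calc; rewrite exp_0; ring. Qed.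

Lemma Rdpower_dexp t c : Rdpower t c = dexp (RtoD (ln t) * c)%D.
Proof.
  unfold Rdpower, Rpower, dexp. rewrite dmul_RtoD. unfold dRe, dDu; cbn [fst snd].
  f_equal; [f_equal; ring|]. rewrite (Rmult_comm (fst c)). ring.
Qed.

Lemma Rdpower_add t c d : Rdpower t (c + d) = (Rdpower t c * Rdpower t d)%D.
Proof. rewrite !Rdpower_dexp, <- dexp_add. f_equal. ring. Qed.

Lemma Rdpower_opp t c : (Rdpower t c * Rdpower t (- c))%D = RtoD 1.
Proof. rewrite <- Rdpower_add, Rdpower_dexp, <- dexp_0. f_equal. ring. Qed.

Lemma Rdpower_mult s t c :
  0 < s -> 0 < t -> Rdpower (s * t) c = (Rdpower s c * Rdpower t c)%D.
Proof.
  intros. rewrite !Rdpower_dexp, <- dexp_add, ln_mult, RtoD_add by easy. f_equal. ring.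
Qed.

Lemma Rdpower_inv t c : 0 < t -> Rdpower (/ t) c = Rdpower t (- c).
Proof.
  intros. rewrite !Rdpower_dexp, ln_Rinv, RtoD_opp by easy. f_equal. ring.
Qed.

Lemma Rdpower_1_l c : Rdpower 1 c = RtoD 1.
Proof. rewrite Rdpower_dexp, ln_1, <- dexp_0. f_equal. ring. Qed.

Lemma Rdpower_RtoD t r : Rdpower t (RtoD r) = RtoD (Rpower t r).
Proof. unfold Rdpower; dual_calc; ring. Qed.

Lemma Rdpower_1_r t : 0 < t -> Rdpower t (RtoD 1) = RtoD t.
Proof. intros. rewrite Rdpower_RtoD, Rpower_1; easy. Qed.

Lemma Rdpower_pred t c :
  0 < t -> (RtoD t * Rdpower t (c - RtoD 1))%D = Rdpower t c.
Proof.
  intros. rewrite <- (Rdpower_1_r t) at 1 by easy. rewrite <- Rdpower_add. f_equal. ring.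
Qed.

Lemma dRe_Rdpower_pos t c : 0 < dRe (Rdpower t c).
Proof. apply exp_pos. Qed.

Lemma dabs_dexp z : dabs (dexp z) = exp (dRe z) * (1 + Rabs (dDu z)).
Proof.
  unfold dabs, dexp, dRe, dDu; cbn [fst snd].
  rewrite Rabs_mult, (Rabs_pos_eq (exp _)) by (left; apply exp_pos). ring.
Qed.

Lemma exp_le_mono x y : x <= y -> exp x <= exp y.
Proof. intros [H| ->]; [left; now apply exp_increasing|right; easy]. Qed.

Lemma Rabs_exp_sub_1 t : Rabs (exp t - 1) <= Rabs t * exp (Rabs t).
Proof.
  pose proof (exp_ineq1_le t). pose proof (exp_ineq1_le (- t)) as H'.
  assert (He : exp t * exp (- t) = 1) by (rewrite <- exp_plus, Rplus_opp_r; apply exp_0).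
  pose proof (exp_pos t).
  destruct (Rle_dec 0 t) as [Ht|Ht].
  - rewrite (Rabs_pos_eq t) by easy. rewrite Rabs_pos_eq by lra. nra.
  - rewrite (Rabs_left t) by lra. rewrite Rabs_left1 by nra.
    pose proof (exp_ineq1_le (- t)). nra.
Qed.

(** First-order accuracy of the exponential; this is what turns the convergence
    of the scaled beta integrands to the gamma integrand into a rate. *)
Lemma dabs_dexp_sub_1 z : dabs (dexp z - RtoD 1) <= dabs z * exp (dabs z).
Proof.
  assert (H1 := Rabs_exp_sub_1 (dRe z)).
  assert (H2 : exp (Rabs (dRe z)) <= exp (dabs z)) by (apply exp_le_mono, dabs_Re).
  assert (H3 : exp (dRe z) <= exp (Rabs (dRe z))) by (apply exp_le_mono, Rle_abs).
  replace (dabs (dexp z - RtoD 1))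
    with (Rabs (exp (dRe z) - 1) + Rabs (exp (dRe z) * dDu z)).
  - rewrite Rabs_mult, (Rabs_pos_eq (exp _)) by (left; apply exp_pos).
    unfold dabs at 1.
    pose proof (Rabs_pos (dRe z)). pose proof (Rabs_pos (dDu z)). nra.
  - unfold dabs, dexp, dsub, dadd, dopp, RtoD, dRe, dDu; cbn [fst snd]. f_equal; f_equal; ring.
Qed.

(** * Limits and derivatives of dual-valued functions *)

Definition dlim {T : Type} (F : (T -> Prop) -> Prop) (f : T -> dual) (l : dual) : Prop :=
  filterlim (fun t => dRe (f t)) F (locally (dRe l)) /\
  filterlim (fun t => dDu (f t)) F (locally (dDu l)).

Lemma filterlim_Rplus_2 {T} {F : (T -> Prop) -> Prop} {FF : Filter F} (f g : T -> R) (lf lg : R) :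
  filterlim f F (locally lf) -> filterlim g F (locally lg) ->
  filterlim (fun t => f t + g t) F (locally (lf + lg)).
Proof.
  intros Hf Hg. exact (filterlim_comp_2 _ _ _ Hf Hg (filterlim_plus (V := R_NormedModule) lf lg)).
Qed.

Lemma filterlim_Rmult_2 {T} {F : (T -> Prop) -> Prop} {FF : Filter F} (f g : T -> R) (lf lg : R) :
  filterlim f F (locally lf) -> filterlim g F (locally lg) ->
  filterlim (fun t => f t * g t) F (locally (lf * lg)).
Proof.
  intros Hf Hg. exact (filterlim_comp_2 _ _ _ Hf Hg (filterlim_mult (K := R_AbsRing) lf lg)).
Qed.

Lemma filterlim_Ropp_1 {T} {F : (T -> Prop) -> Prop} {FF : Filter F} (f : T -> R) (lf : R) :
  filterlim f F (locally lf) -> filterlim (fun t => - f t) F (locally (- lf)).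
Proof.
  intros Hf. exact (filterlim_comp _ _ _ _ _ _ _ _ Hf (filterlim_opp (V := R_NormedModule) lf)).
Qed.

Lemma filterlim_Rinv_1 {T} {F : (T -> Prop) -> Prop} {FF : Filter F} (f : T -> R) (lf : R) :
  lf <> 0 -> filterlim f F (locally lf) -> filterlim (fun t => / f t) F (locally (/ lf)).
Proof.
  intros H0 Hf. refine (filterlim_comp _ _ _ _ Rinv _ _ _ Hf _).
  apply (filterlim_Rbar_inv (Finite lf)). intros H. apply H0. now injection H.
Qed.

Section Dlim.
Context {T : Type} {F : (T -> Prop) -> Prop} {FF : ProperFilter F}.
Implicit Types (f g : T -> dual) (l m : dual).

Lemma dlim_const l : dlim F (fun _ => l) l.
Proof. split; apply filterlim_const. Qed.

Lemma dlim_add f g l m : dlim F f l -> dlim F g m -> dlim F (fun t => f t + g t)%D (l + m).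
Proof. intros [H1 H2] [H3 H4]; split; now apply filterlim_Rplus_2. Qed.

Lemma dlim_opp f l : dlim F f l -> dlim F (fun t => - f t)%D (- l).
Proof. intros [H1 H2]; split; now apply filterlim_Ropp_1. Qed.

Lemma dlim_sub f g l m : dlim F f l -> dlim F g m -> dlim F (fun t => f t - g t)%D (l - m).
Proof. intros H1 H2. apply dlim_add; [easy|now apply dlim_opp]. Qed.

Lemma dlim_mul f g l m : dlim F f l -> dlim F g m -> dlim F (fun t => f t * g t)%D (l * m).
Proof.
  intros [H1 H2] [H3 H4]; split; [now apply filterlim_Rmult_2|].
  apply filterlim_Rplus_2; now apply filterlim_Rmult_2.
Qed.

Lemma dlim_inv f l : dRe l <> 0 -> dlim F f l -> dlim F (fun t => dinv (f t)) (dinv l).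
Proof.
  intros H0 [H1 H2]; split; [now apply filterlim_Rinv_1|].
  apply filterlim_Ropp_1, filterlim_Rmult_2; [easy|].
  apply filterlim_Rinv_1; [now apply pow_nonzero|].
  apply filterlim_Rmult_2; [easy|]. apply filterlim_Rmult_2; [easy|].
  apply filterlim_const.
Qed.

Lemma dlim_ext_loc f g l : F (fun t => f t = g t) -> dlim F f l -> dlim F g l.
Proof.
  intros He [H1 H2]; split; (eapply filterlim_ext_loc; [|eassumption]);
    (eapply filter_imp; [|exact He]); intros t Ht; cbv beta in Ht; now rewrite Ht.
Qed.

Lemma dlim_unique f l m : dlim F f l -> dlim F f m -> l = m.
Proof.
  intros [H1 H2] [H3 H4]; apply dual_ext;
    eapply (filterlim_locally_unique (V := R_NormedModule) (F := F)); eassumption.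
Qed.

Lemma filterlim_le_0 (f g : T -> R) :
  F (fun t => Rabs (f t) <= g t) -> filterlim g F (locally 0) -> filterlim f F (locally 0).
Proof.
  intros Hle Hg.
  apply (filterlim_le_le (F := F) (fun t => - g t) f g (Finite 0)); [|..|easy].
  - (eapply filter_imp; [|exact Hle]); intros t Ht; cbv beta in *. now apply Rabs_le_between.
  - rewrite <- Ropp_0. now apply filterlim_Ropp_1.
Qed.

Lemma dlim_squeeze f l (g : T -> R) :
  F (fun t => dabs (f t - l) <= g t) -> filterlim g F (locally 0) -> dlim F f l.
Proof.
  intros Hle Hg.
  assert (H : dlim F (fun t => f t - l)%D (RtoD 0)).
  { split; apply filterlim_le_0 with g; try easy; (eapply filter_imp; [|exact Hle]); intros t Ht; cbv beta in *;
      eapply Rle_trans; try eassumption; [apply dabs_Re|apply dabs_Du]. }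
  replace l with (RtoD 0 + l)%D by ring.
  apply dlim_ext_loc with (fun t => (f t - l) + l)%D.
  - apply filter_forall. intros t. ring.
  - apply dlim_add; [easy|apply dlim_const].
Qed.

Lemma dlim_dabs f l : dlim F f l -> filterlim (fun t => dabs (f t)) F (locally (dabs l)).
Proof.
  intros [H1 H2].
  apply filterlim_Rplus_2;
    (refine (filterlim_comp _ _ _ _ Rabs _ _ _ _ (continuous_Rabs _)); easy).
Qed.

End Dlim.

Lemma dlim_comp {T U} (F : (T -> Prop) -> Prop) (G : (U -> Prop) -> Prop) (h : T -> U) f l :
  filterlim h F G -> dlim G f l -> dlim F (fun t => f (h t)) l.
Proof.
  intros Hh [H1 H2]; split.
  - exact (filterlim_comp _ _ _ h (fun u => dRe (f u)) _ _ _ Hh H1).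
  - exact (filterlim_comp _ _ _ h (fun u => dDu (f u)) _ _ _ Hh H2).
Qed.

Lemma dlim_seq_bounded (f : nat -> dual) l :
  dlim eventually f l -> exists C, forall n, dabs (f n) <= C.
Proof.
  intros H. apply dlim_dabs in H.
  destruct (filterlim_bounded (V := R_NormedModule) (fun n => dabs (f n))) as [M HM].
  { now exists (dabs l). }
  exists M. intros n. eapply Rle_trans; [apply Rle_abs|exact (HM n)].
Qed.

Definition dderive (f : R -> dual) (x : R) (l : dual) : Prop :=
  is_derive (fun t => dRe (f t)) x (dRe l) /\ is_derive (fun t => dDu (f t)) x (dDu l).

Lemma dderive_const c x : dderive (fun _ => c) x (RtoD 0).
Proof. split; apply (is_derive_const (V := R_NormedModule)). Qed.

Lemma dderive_add f g x l m :
  dderive f x l -> dderive g x m -> dderive (fun t => f t + g t)%D x (l + m)%D.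
Proof. intros [H1 H2] [H3 H4]; split; now apply (is_derive_plus (V := R_NormedModule)). Qed.

Lemma dderive_opp f x l : dderive f x l -> dderive (fun t => - f t)%D x (- l)%D.
Proof. intros [H1 H2]; split; now apply (is_derive_opp (V := R_NormedModule)). Qed.

Lemma dderive_sub f g x l m :
  dderive f x l -> dderive g x m -> dderive (fun t => f t - g t)%D x (l - m)%D.
Proof. intros. apply dderive_add; [easy|now apply dderive_opp]. Qed.

Lemma is_derive_Rmult (u v : R -> R) (x du dv : R) :
  is_derive u x du -> is_derive v x dv ->
  is_derive (fun t => u t * v t) x (du * v x + u x * dv).
Proof. intros Hu Hv. exact (is_derive_mult (K := R_AbsRing) u v x du dv Hu Hv Rmult_comm). Qed.

Lemma dderive_mul f g x l m :
  dderive f x l -> dderive g x m ->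
  dderive (fun t => f t * g t)%D x (l * g x + f x * m)%D.
Proof.
  intros [H1 H2] [H3 H4].
  split.
  - exact (is_derive_Rmult _ _ _ _ _ H1 H3).
  - assert (E : dDu (l * g x + f x * m)%D =
        (dRe l * dDu (g x) + dRe (f x) * dDu m) + (dDu l * dRe (g x) + dDu (f x) * dRe m))
      by (unfold dadd, dmul, dRe, dDu; cbn [fst snd]; ring).
    rewrite E.
    exact (is_derive_plus (V := R_NormedModule) _ _ _ _ _
             (is_derive_Rmult _ _ _ _ _ H1 H4) (is_derive_Rmult _ _ _ _ _ H2 H3)).
Qed.

Lemma dderive_scal c f x l : dderive f x l -> dderive (fun t => c * f t)%D x (c * l)%D.
Proof.
  intros H. replace (c * l)%D with (RtoD 0 * f x + c * l)%D by ring.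
  exact (dderive_mul _ _ _ _ _ (dderive_const c x) H).
Qed.

Lemma dderive_RtoD (f : R -> R) (x l : R) :
  is_derive f x l -> dderive (fun t => RtoD (f t)) x (RtoD l).
Proof. intros H; split; [exact H|exact (is_derive_const (V := R_NormedModule) 0 x)]. Qed.

Lemma dderive_comp (f : R -> dual) (h : R -> R) (x : R) l (dh : R) :
  dderive f (h x) l -> is_derive h x dh -> dderive (fun t => f (h t)) x (RtoD dh * l)%D.
Proof.
  intros [H1 H2] Hh. rewrite dmul_RtoD.
  split.
  - exact (is_derive_comp (V := R_NormedModule) (fun t => dRe (f t)) h x _ _ H1 Hh).
  - exact (is_derive_comp (V := R_NormedModule) (fun t => dDu (f t)) h x _ _ H2 Hh).
Qed.

Lemma dderive_ext f g x l :
  locally x (fun t => f t = g t) -> dderive f x l -> dderive g x l.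
Proof.
  intros He [H1 H2]; split; (eapply is_derive_ext_loc; [|eassumption]);
    (eapply filter_imp; [|exact He]); intros t Ht; cbv beta in Ht; now rewrite Ht.
Qed.

Lemma dderive_dexp f x l :
  dderive f x l -> dderive (fun t => dexp (f t)) x (l * dexp (f x))%D.
Proof.
  intros [H1 H2].
  assert (He : is_derive (fun t => exp (dRe (f t))) x (dRe l * exp (dRe (f x)))).
  { exact (is_derive_comp (V := R_NormedModule) exp (fun t => dRe (f t)) x _ _ (is_derive_exp _) H1). }
  split; [easy|].
  assert (E : dDu (l * dexp (f x))%D =
      dRe l * exp (dRe (f x)) * dDu (f x) + exp (dRe (f x)) * dDu l)
    by (unfold dexp, dmul, dRe, dDu; cbn [fst snd]; ring).
  rewrite E. exact (is_derive_Rmult _ _ _ _ _ He H2).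
Qed.

Lemma dderive_Rdpower (h : R -> R) (x dh : R) c :
  0 < h x -> is_derive h x dh ->
  dderive (fun t => Rdpower (h t) c) x (RtoD dh * c * Rdpower (h x) (c - RtoD 1))%D.
Proof.
  intros Hp Hh.
  assert (Hl : is_derive (fun t => ln (h t)) x (dh * / h x)).
  { exact (is_derive_comp (V := R_NormedModule) ln h x _ _ (is_derive_ln _ Hp) Hh). }
  apply dderive_ext with (fun t => dexp (c * RtoD (ln (h t))))%D.
  { apply filter_forall. intros t. rewrite Rdpower_dexp. f_equal. ring. }
  replace (RtoD dh * c * Rdpower (h x) (c - RtoD 1))%D
    with (c * RtoD (dh * / h x) * dexp (c * RtoD (ln (h x))))%D.
  - apply dderive_dexp, dderive_scal, dderive_RtoD, Hl.
  - replace (dexp (c * RtoD (ln (h x))))%D with (Rdpower (h x) c)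
      by (rewrite Rdpower_dexp; f_equal; ring).
    rewrite <- (Rdpower_pred (h x) c) by easy. rewrite RtoD_mul.
    transitivity (RtoD dh * c * Rdpower (h x) (c - RtoD 1) * (RtoD (/ h x) * RtoD (h x)))%D; [ring|].
    rewrite <- RtoD_mul, Rinv_l by lra. ring.
Qed.

Lemma dderive_0_const (a b : Rbar) f :
  (forall u : R, Rbar_lt a u -> Rbar_lt u b -> dderive f u (RtoD 0)) ->
  forall x y : R, Rbar_lt a x -> Rbar_lt x b -> Rbar_lt a y -> Rbar_lt y b -> f x = f y.
Proof.
  intros Hf.
  assert (H : forall x y : R, x < y -> Rbar_lt a x -> Rbar_lt y b -> f x = f y).
  { intros x y Hxy Hx Hy.
    assert (Hin : forall t, x <= t <= y -> dderive f t (RtoD 0)).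
    { intros t [Ht1 Ht2]. apply Hf; [eapply Rbar_lt_le_trans|eapply Rbar_le_lt_trans];
        try eassumption; easy. }
    apply dual_ext.
    - apply (eq_is_derive (V := R_NormedModule) (fun t => dRe (f t))); [|easy].
      intros t Ht. apply (Hin t Ht).
    - apply (eq_is_derive (V := R_NormedModule) (fun t => dDu (f t))); [|easy].
      intros t Ht. apply (Hin t Ht). }
  intros x y Hx1 Hx2 Hy1 Hy2. destruct (Rtotal_order x y) as [L|[->|L]]; [|easy|].
  - now apply H.
  - symmetry. now apply H.
Qed.

(** * Improper integrals through primitives *)

Lemma is_RInt_gen_primitive (a b : Rbar) (Fa Fb : (R -> Prop) -> Prop)
    {FFa : Filter Fa} {FFb : Filter Fb} (f P : R -> R) (la lb : R) :
  Fa (fun u : R => Rbar_lt a u /\ Rbar_lt u b) -> Fb (fun u : R => Rbar_lt a u /\ Rbar_lt u b) ->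
  (forall u : R, Rbar_lt a u -> Rbar_lt u b -> is_derive P u (f u)) ->
  (forall u : R, Rbar_lt a u -> Rbar_lt u b -> ex_derive f u) ->
  filterlim P Fa (locally la) -> filterlim P Fb (locally lb) ->
  is_RInt_gen f Fa Fb (lb - la).
Proof.
  intros Da Db HP Hf La Lb Q HQ.
  assert (Hlim : filterlim (fun ab => P (snd ab) - P (fst ab)) (filter_prod Fa Fb) (locally (lb - la))).
  { apply filterlim_Rplus_2.
    - exact (filterlim_comp _ _ _ snd P _ _ _ filterlim_snd Lb).
    - apply filterlim_Ropp_1. exact (filterlim_comp _ _ _ fst P _ _ _ filterlim_fst La). }
  assert (HD : filter_prod Fa Fb (fun ab : R * R =>
             (Rbar_lt a (fst ab) /\ Rbar_lt (fst ab) b) /\ (Rbar_lt a (snd ab) /\ Rbar_lt (snd ab) b))).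
  { now exists (fun u : R => Rbar_lt a u /\ Rbar_lt u b) (fun u : R => Rbar_lt a u /\ Rbar_lt u b). }
  assert (HQ' : filter_prod Fa Fb (fun ab : R * R => Q (P (snd ab) - P (fst ab)))) by exact (Hlim Q HQ).
  unfold filtermapi.
  refine (filter_imp _ _ _ (filter_and _ _ HD HQ')).
  intros [x y] [[[Hx1 Hx2] [Hy1 Hy2]] Hxy]; cbn [fst snd] in *.
  exists (P y - P x). split; [|exact Hxy].
  assert (Hin : forall z, Rmin x y <= z <= Rmax x y -> Rbar_lt a z /\ Rbar_lt z b).
  { intros z [Hz1 Hz2]. split.
    - apply Rbar_lt_le_trans with (Rmin x y); [now apply Rmin_case|easy].
    - apply Rbar_le_lt_trans with (Rmax x y); [easy|now apply Rmax_case]. }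
  apply (is_RInt_derive (V := R_CompleteNormedModule)).
  - intros z Hz. apply HP; apply Hin; easy.
  - intros z Hz. apply (ex_derive_continuous (V := R_NormedModule)), Hf; apply Hin; easy.
Qed.

Lemma is_RInt_gen_pair (Fa Fb : (R -> Prop) -> Prop) {FFa : Filter Fa} {FFb : Filter Fb}
    (f : R -> dual) (v : dual) :
  is_RInt_gen (fun t => dRe (f t)) Fa Fb (dRe v) ->
  is_RInt_gen (fun t => dDu (f t)) Fa Fb (dDu v) ->
  is_RInt_gen (V := dual_NormedModule) f Fa Fb v.
Proof.
  intros H1 H2 Q [eps HQ].
  specialize (H1 _ (locally_ball _ eps)). specialize (H2 _ (locally_ball _ eps)).
  unfold filtermapi in *.
  refine (filter_imp _ _ _ (filter_and _ _ H1 H2)). intros ab [[y1 [I1 B1]] [y2 [I2 B2]]].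
  exists (y1, y2). split.
  - now apply (is_RInt_fct_extend_pair (U := R_NormedModule) (V := R_NormedModule)).
  - apply HQ. now split.
Qed.

Definition dprimitive (a b : Rbar) (f P : R -> dual) : Prop :=
  forall u : R, Rbar_lt a u -> Rbar_lt u b -> dderive P u (f u).

Definition dderivable (a b : Rbar) (f : R -> dual) : Prop :=
  forall u : R, Rbar_lt a u -> Rbar_lt u b -> exists l, dderive f u l.

Section Primitive.
Context (a b : Rbar) (Fa Fb : (R -> Prop) -> Prop) {FFa : Filter Fa} {FFb : Filter Fb}.
Hypothesis Da : Fa (fun u : R => Rbar_lt a u /\ Rbar_lt u b).
Hypothesis Db : Fb (fun u : R => Rbar_lt a u /\ Rbar_lt u b).

(** The fundamental theorem of calculus reduces every integral below to a
    primitive with known limits, so that changes of variable become instances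
    of the chain rule. *)
Lemma is_RInt_gen_dprimitive (f P : R -> dual) (la lb : dual) :
  dprimitive a b f P -> dderivable a b f -> dlim Fa P la -> dlim Fb P lb ->
  is_RInt_gen (fun t => dRe (f t)) Fa Fb (dRe (lb - la)%D) /\
  is_RInt_gen (fun t => dDu (f t)) Fa Fb (dDu (lb - la)%D).
Proof.
  intros HP Hf [La1 La2] [Lb1 Lb2].
  split; eapply is_RInt_gen_primitive; try eassumption;
    intros u Hu1 Hu2; try apply (HP u Hu1 Hu2);
    destruct (Hf u Hu1 Hu2) as [l [H1 H2]]; eexists; eassumption.
Qed.

Lemma is_dRInt_primitive (f P : R -> dual) (l : dual) :
  dprimitive a b f P -> dderivable a b f -> dlim Fa P (RtoD 0) -> dlim Fb P l ->
  is_RInt_gen (V := dual_NormedModule) f Fa Fb l.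
Proof.
  intros HP Hf La Lb.
  destruct (is_RInt_gen_dprimitive f P _ _ HP Hf La Lb) as [H1 H2].
  apply (is_RInt_gen_pair Fa Fb f l).
  - now replace (dRe l) with (dRe (l - RtoD 0)%D) by (cbn; ring).
  - now replace (dDu l) with (dDu (l - RtoD 0)%D) by (cbn; ring).
Qed.
End Primitive.

Lemma at_right_Ioo x y : x < y -> at_right x (fun u : R => Rbar_lt (Finite x) u /\ Rbar_lt u (Finite y)).
Proof.
  intros H. exists (mkposreal (y - x) ltac:(lra)). intros u Hu Hxu.
  apply Rabs_lt_between' in Hu; cbn in *. lra.
Qed.

Lemma at_left_Ioo x y : x < y -> at_left y (fun u : R => Rbar_lt (Finite x) u /\ Rbar_lt u (Finite y)).
Proof.
  intros H. exists (mkposreal (y - x) ltac:(lra)). intros u Hu Hxu.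
  apply Rabs_lt_between' in Hu; cbn in *. lra.
Qed.

Lemma at_right_Ioi x : at_right x (fun u : R => Rbar_lt (Finite x) u /\ Rbar_lt u p_infty).
Proof. exists (mkposreal 1 Rlt_0_1). intros u _ Hu. now split. Qed.

Lemma p_infty_Ioi x : Rbar_locally p_infty (fun u : R => Rbar_lt (Finite x) u /\ Rbar_lt u p_infty).
Proof. exists x. intros u Hu. now split. Qed.

Lemma is_derive_ge0_mono (f df : R -> R) (x y : R) :
  (forall t, x <= t <= y -> is_derive f t (df t)) ->
  (forall t, x <= t <= y -> 0 <= df t) -> x <= y -> f x <= f y.
Proof.
  intros Hd Hp Hxy.
  destruct (MVT_gen f x y df) as [c [Hc E]].
  - intros t Ht. rewrite Rmin_left, Rmax_right in Ht by easy. apply Hd. lra.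
  - intros t Ht. rewrite Rmin_left, Rmax_right in Ht by easy.
    apply continuity_pt_filterlim, (ex_derive_continuous (V := R_NormedModule)).
    exists (df t). now apply Hd.
  - rewrite Rmin_left, Rmax_right in Hc by easy. specialize (Hp c Hc). nra.
Qed.

(** A primitive whose increments are dominated by those of a convergent
    function converges, by Cauchy's criterion. *)
Lemma filterlim_dominated (F : (R -> Prop) -> Prop) {FF : ProperFilter F}
    (D : R -> Prop) (f G : R -> R) (C l : R) :
  F D -> 0 < C -> filterlim G F (locally l) ->
  (forall x y, D x -> D y -> Rabs (f y - f x) <= C * Rabs (G y - G x)) ->
  exists m, filterlim f F (locally m).
Proof.
  intros HD HC HG Hd.
  apply (filterlim_locally_cauchy (U := R_CompleteSpace)). intros eps.
  assert (He : 0 < eps / (2 * C)) by (apply Rdiv_lt_0_compat; [apply eps|lra]).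
  exists (fun x => D x /\ ball l (mkposreal _ He) (G x)). split.
  - apply filter_and; [easy|]. apply HG, locally_ball.
  - intros u v [Du Bu] [Dv Bv].
    apply Rabs_lt_between' in Bu. apply Rabs_lt_between' in Bv. cbn in Bu, Bv.
    assert (HGuv : Rabs (G v - G u) < 2 * (eps / (2 * C))) by (apply Rabs_def1; lra).
    apply (Rle_lt_trans _ _ _ (Hd u v Du Dv)).
    apply Rmult_lt_compat_l with (r := C) in HGuv; [|easy].
    replace (C * (2 * (eps / (2 * C)))) with (pos eps) in HGuv by (field; lra). exact HGuv.
Qed.

(** A bounded increasing function on the half-line whose derivative dominates,
    up to a constant, both [t^(c-1) ln t] near 0 for any [c > d] and every
    exponentially decaying function near infinity. *)
Definition cmaj (d t : R) : R := Rpower (t / (1 + t)) d.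
Definition maj (d t : R) : R := d / (t * (1 + t)) * cmaj d t.

Lemma is_derive_cmaj d t : 0 < t -> is_derive (cmaj d) t (maj d t).
Proof.
  intros Ht. assert (0 < t / (1 + t)) by (apply Rdiv_lt_0_compat; lra).
  unfold cmaj, maj, Rpower. auto_derive.
  - repeat split; lra.
  - unfold cmaj, Rpower, Rdiv. field. repeat split; lra.
Qed.

Lemma cmaj_bounds d t : 0 < d -> 0 < t -> 0 <= cmaj d t <= 1.
Proof.
  intros. unfold cmaj, Rpower. split; [left; apply exp_pos|].
  assert (0 < t / (1 + t)) by (apply Rdiv_lt_0_compat; lra).
  assert (t / (1 + t) <= 1) by (apply Rle_div_l; lra).
  assert (ln (t / (1 + t)) <= ln 1) by (apply ln_le; easy).
  rewrite ln_1 in *. apply Rle_trans with (exp 0); [|rewrite exp_0; lra].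
  apply exp_le_mono. nra.
Qed.

Lemma filterlim_cmaj_infty d : filterlim (cmaj d) (Rbar_locally p_infty) (locally 1).
Proof.
  assert (H : filterlim (fun t => t / (1 + t)) (Rbar_locally p_infty) (locally 1)).
  { apply filterlim_ext_loc with (fun t => 1 + - / (1 + t)).
    - exists 0. intros t Ht. field. lra.
    - replace (locally 1) with (locally (1 + - 0)) by (f_equal; ring).
      apply (filterlim_Rplus_2 (fun _ => 1)); [apply filterlim_const|]. apply filterlim_Ropp_1.
      apply (is_lim_inv (fun t => 1 + t) p_infty p_infty); [|easy].
      apply (is_lim_plus (fun _ => 1) (fun t => t) p_infty 1 p_infty p_infty);
        [apply is_lim_const|apply is_lim_id|easy]. }
  replace 1 with (Rpower 1 d) at 1 by (unfold Rpower; rewrite ln_1, Rmult_0_r; apply exp_0).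
  apply (filterlim_comp _ _ _ _ (fun y => Rpower y d) _ _ _ H).
  apply (ex_derive_continuous (V := R_NormedModule) (fun y => Rpower y d)).
  unfold Rpower. auto_derive. lra.
Qed.

Lemma filterlim_Rpower_0 d : 0 < d -> filterlim (fun t => Rpower t d) (at_right 0) (locally 0).
Proof.
  intros Hd. unfold Rpower.
  refine (filterlim_comp _ _ _ (fun t => d * ln t) exp _ _ _ _ is_lim_exp_m).
  assert (H := filterlim_Rbar_mult_l d m_infty).
  replace (Rbar_mult d m_infty) with m_infty in H.
  - exact (filterlim_comp _ _ _ _ _ _ _ _ is_lim_ln_0 H).
  - symmetry. apply is_Rbar_mult_unique, is_Rbar_mult_sym, is_Rbar_mult_m_infty_pos. exact Hd.
Qed.

Lemma filterlim_cmaj_0 d : 0 < d -> filterlim (cmaj d) (at_right 0) (locally 0).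
Proof.
  intros Hd.
  apply filterlim_le_0 with (fun t => Rpower t d); [|now apply filterlim_Rpower_0].
  exists (mkposreal 1 Rlt_0_1). intros t _ Ht.
  rewrite Rabs_pos_eq by now apply cmaj_bounds.
  unfold cmaj, Rpower. apply exp_le_mono, Rmult_le_compat_l; [lra|].
  apply ln_le; [apply Rdiv_lt_0_compat; lra|].
  apply Rle_div_l; nra.
Qed.

(** [C * cmaj d + P] and [C * cmaj d - P] are increasing, so the increments of
    [P] are controlled by those of [C * cmaj d]. *)
Lemma primitive_dominated (f : R -> R) (d C : R) :
  0 < d -> 0 < C ->
  (forall t, 0 < t -> ex_derive f t) ->
  (forall t, 0 < t -> Rabs (f t) <= C * maj d t) ->
  exists P v, (forall t, 0 < t -> is_derive P t (f t)) /\
    filterlim P (at_right 0) (locally 0) /\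
    filterlim P (Rbar_locally p_infty) (locally v) /\ Rabs v <= C.
Proof.
  intros Hd HC Hf Hle.
  assert (Hcont : forall t, 0 < t -> continuous f t).
  { intros t Ht. apply (ex_derive_continuous (V := R_NormedModule)). now apply Hf. }
  set (P0 := RInt f 1).
  assert (HP0 : forall t, 0 < t -> is_derive P0 t (f t)).
  { intros t Ht. apply (is_derive_RInt (V := R_NormedModule) f P0 1 t); [|now apply Hcont].
    exists (mkposreal t Ht). intros y Hy. apply Rabs_lt_between' in Hy; cbn in Hy.
    apply (RInt_correct (V := R_CompleteNormedModule)), (ex_RInt_continuous (V := R_CompleteNormedModule)).
    intros z [Hz _]. apply Hcont. apply Rlt_le_trans with (2 := Hz). apply Rmin_case; lra. }
  assert (Hmono : forall x y, 0 < x -> x <= y ->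
             Rabs (P0 y - P0 x) <= C * (cmaj d y - cmaj d x)).
  { intros x y Hx Hxy. apply Rabs_le. split.
    - enough (C * cmaj d x + P0 x <= C * cmaj d y + P0 y) by lra.
      apply (is_derive_ge0_mono (fun t => C * cmaj d t + P0 t) (fun t => C * maj d t + f t) x y);
        [| |easy]; intros t Ht.
      + apply (is_derive_plus (V := R_NormedModule)); [|apply HP0; lra].
        apply is_derive_scal, is_derive_cmaj. lra.
      + specialize (Hle t ltac:(lra)). apply Rabs_le_between in Hle. lra.
    - enough (C * cmaj d x - P0 x <= C * cmaj d y - P0 y) by lra.
      apply (is_derive_ge0_mono (fun t => C * cmaj d t - P0 t) (fun t => C * maj d t - f t) x y);
        [| |easy]; intros t Ht.
      + apply (is_derive_minus (V := R_NormedModule)); [|apply HP0; lra].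
        apply is_derive_scal, is_derive_cmaj. lra.
      + specialize (Hle t ltac:(lra)). apply Rabs_le_between in Hle. lra. }
  assert (Hinc : forall x y, 0 < x -> 0 < y -> Rabs (P0 y - P0 x) <= C * Rabs (cmaj d y - cmaj d x)).
  { intros x y Hx Hy. destruct (Rle_dec x y) as [L|L].
    - apply (Rle_trans _ _ _ (Hmono x y Hx L)). apply Rmult_le_compat_l; [lra|]. apply Rle_abs.
    - rewrite Rabs_minus_sym, (Rabs_minus_sym (cmaj d y)).
      apply (Rle_trans _ _ _ (Hmono y x Hy ltac:(lra))). apply Rmult_le_compat_l; [lra|]. apply Rle_abs. }
  destruct (filterlim_dominated (at_right 0) (fun t => 0 < t) P0 (cmaj d) C 0) as [m0 Hm0]; try easy.
  { exists (mkposreal 1 Rlt_0_1). now intros. }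
  { now apply filterlim_cmaj_0. }
  destruct (filterlim_dominated (Rbar_locally p_infty) (fun t => 0 < t) P0 (cmaj d) C 1) as [m1 Hm1]; try easy.
  { now exists 0. }
  { now apply filterlim_cmaj_infty. }
  exists (fun t => P0 t + - m0), (m1 + - m0). split; [|split; [|split]].
  - intros t Ht. rewrite <- (Rplus_0_r (f t)).
    exact (is_derive_plus (V := R_NormedModule) _ _ _ _ _ (HP0 t Ht) (is_derive_const (V := R_NormedModule) (- m0) t)).
  - replace (locally 0) with (locally (m0 + - m0)) by (f_equal; ring). apply filterlim_Rplus_2; [easy|apply filterlim_const].
  - apply filterlim_Rplus_2; [easy|apply filterlim_const].
  - assert (Hx : forall y, 0 < y -> Rabs (P0 y + - m0) <= C).
    { intros y Hy.
      apply (filterlim_le (F := at_right 0) (fun x => Rabs (P0 y + - P0 x)) (fun _ => C)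
               (Finite (Rabs (P0 y + - m0))) (Finite C)).
      - exists (mkposreal 1 Rlt_0_1). intros x _ Hx.
        apply (Rle_trans _ _ _ (Hinc x y Hx Hy)).
        assert (Rabs (cmaj d y - cmaj d x) <= 1); [|nra].
        pose proof (cmaj_bounds d x Hd Hx). pose proof (cmaj_bounds d y Hd Hy). apply Rabs_le. lra.
      - refine (filterlim_comp _ _ _ _ Rabs _ _ _ _ (continuous_Rabs _)).
        apply filterlim_Rplus_2; [apply filterlim_const|]. now apply filterlim_Ropp_1.
      - apply filterlim_const. }
    apply (filterlim_le (F := Rbar_locally p_infty) (fun y => Rabs (P0 y + - m0)) (fun _ => C)
             (Finite (Rabs (m1 + - m0))) (Finite C)).
    + now exists 0.
    + refine (filterlim_comp _ _ _ _ Rabs _ _ _ _ (continuous_Rabs _)).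
      apply filterlim_Rplus_2; [easy|apply filterlim_const].
    + apply filterlim_const.
Qed.

Lemma dprimitive_dominated (f : R -> dual) (d C : R) :
  0 < d -> 0 < C -> dderivable 0 p_infty f ->
  (forall t, 0 < t -> dabs (f t) <= C * maj d t) ->
  exists P v, dprimitive 0 p_infty f P /\
    dlim (at_right 0) P (RtoD 0) /\ dlim (Rbar_locally p_infty) P v /\ dabs v <= 2 * C.
Proof.
  intros Hd HC Hf Hle.
  destruct (primitive_dominated (fun t => dRe (f t)) d C) as (P1 & v1 & HP1 & H01 & Hv1 & Hb1); try easy.
  { intros t Ht. destruct (Hf t Ht I) as [l [H _]]. now exists (dRe l). }
  { intros t Ht. apply Rle_trans with (2 := Hle t Ht), dabs_Re. }
  destruct (primitive_dominated (fun t => dDu (f t)) d C) as (P2 & v2 & HP2 & H02 & Hv2 & Hb2); try easy.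
  { intros t Ht. destruct (Hf t Ht I) as [l [_ H]]. now exists (dDu l). }
  { intros t Ht. apply Rle_trans with (2 := Hle t Ht), dabs_Du. }
  exists (fun t => (P1 t, P2 t)), (v1, v2).
  split; [|split; [now split|split; [now split|]]].
  - intros t Ht _. split; [now apply HP1|now apply HP2].
  - unfold dabs, dRe, dDu; cbn [fst snd]. lra.
Qed.

(** * The dual gamma function *)

Lemma Rabs_ln_le d y : 0 < d -> Rabs (ln y) <= (Rpower y d + Rpower y (- d)) / d.
Proof.
  intros Hd. unfold Rpower.
  pose proof (exp_ineq1_le (d * ln y)). pose proof (exp_ineq1_le (- d * ln y)).
  pose proof (exp_pos (d * ln y)). pose proof (exp_pos (- d * ln y)).
  apply Rle_div_r; [easy|]. rewrite <- (Rabs_pos_eq d) at 1 by lra. rewrite <- Rabs_mult.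
  apply Rabs_le. lra.
Qed.

(** The logarithm in the dual part costs an arbitrarily small power. *)
Lemma dabs_Rdpower_le d c y :
  0 < d ->
  dabs (Rdpower y c)
    <= (1 + Rabs (dDu c) / d) * (Rpower y (dRe c + d) + Rpower y (dRe c - d)).
Proof.
  intros Hd.
  replace (dabs (Rdpower y c)) with (Rpower y (dRe c) * (1 + Rabs (dDu c) * Rabs (ln y))).
  2:{ rewrite Rdpower_dexp, dabs_dexp, dmul_RtoD. unfold Rpower, dRe, dDu; cbn [fst snd].
      rewrite Rabs_mult, (Rmult_comm (fst c)). ring. }
  replace (Rpower y (dRe c + d) + Rpower y (dRe c - d))
    with (Rpower y (dRe c) * (Rpower y d + Rpower y (- d)))
    by (unfold Rminus; rewrite !Rpower_plus; ring).
  pose proof (Rabs_ln_le d y Hd) as Hln.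
  assert (H1 : 1 <= Rpower y d + Rpower y (- d)).
  { unfold Rpower.
    pose proof (exp_ineq1_le (d * ln y)). pose proof (exp_ineq1_le (- d * ln y)). lra. }
  assert (Hp : 0 < Rpower y (dRe c)) by apply exp_pos.
  assert (H2 : Rabs (dDu c) * Rabs (ln y) <= Rabs (dDu c) / d * (Rpower y d + Rpower y (- d))).
  { replace (Rabs (dDu c) / d * (Rpower y d + Rpower y (- d)))
      with (Rabs (dDu c) * ((Rpower y d + Rpower y (- d)) / d)) by (field; lra).
    apply Rmult_le_compat_l; [apply Rabs_pos|easy]. }
  replace ((1 + Rabs (dDu c) / d) * (Rpower y (dRe c) * (Rpower y d + Rpower y (- d))))
    with (Rpower y (dRe c) * ((1 + Rabs (dDu c) / d) * (Rpower y d + Rpower y (- d)))) by ring.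
  apply Rmult_le_compat_l; lra.
Qed.

Lemma exp_decay_le_maj d :
  0 < d -> exists K, 0 < K /\ forall t, 0 < t ->
    (1 + t) * exp (- (t / 2)) * (Rpower t (3 * d - 1) + Rpower t (d - 1)) <= K * maj d t.
Proof.
  intros Hd. set (m := 2 + 3 * d). set (k := 1 / 2 + m * ln (2 * m)).
  exists (2 * exp k / d). split.
  { apply Rdiv_lt_0_compat; [|easy]. pose proof (exp_pos k). lra. }
  intros t Ht. set (L := ln t). set (M := ln (1 + t)).
  assert (HM : exp M = 1 + t) by (apply exp_ln; lra).
  assert (HL : exp L = t) by now apply exp_ln.
  assert (HM0 : 0 <= M) by (rewrite <- ln_1; apply ln_le; lra).
  assert (HLM : L <= M) by (apply ln_le; lra).
  assert (Hm : 0 < m) by (unfold m; lra).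
  (* the tangent of [ln] at [2 * m] *)
  assert (HMt : m * M <= t / 2 + k).
  { assert (H : M <= (1 + t) / (2 * m) - 1 + ln (2 * m)).
    { replace M with (ln ((1 + t) / (2 * m)) + ln (2 * m)).
      - assert (0 < (1 + t) / (2 * m)) by (apply Rdiv_lt_0_compat; lra).
        pose proof (exp_ineq1_le (ln ((1 + t) / (2 * m)))) as E. rewrite exp_ln in E by easy. lra.
      - rewrite <- ln_mult; [|apply Rdiv_lt_0_compat; lra|lra]. unfold M. f_equal. field. lra. }
    apply Rmult_le_compat_l with (r := m) in H; [|lra].
    replace (m * ((1 + t) / (2 * m) - 1 + ln (2 * m)))
      with ((1 + t) / 2 - m + m * ln (2 * m)) in H by (field; lra).
    unfold k. lra. }
  replace (2 * exp k / d * maj d t) with (2 * exp (k + (- L - M + d * (L - M)))).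
  2:{ unfold maj, cmaj, Rpower. rewrite ln_div by lra. fold L M.
      rewrite 2!exp_plus. unfold Rminus at 1. rewrite exp_plus, !exp_Ropp, HM, HL.
      field. lra. }
  unfold Rpower. fold L. rewrite <- HM, <- exp_plus, Rmult_plus_distr_l, <- !exp_plus.
  assert (exp (M + - (t / 2) + (3 * d - 1) * L) <= exp (k + (- L - M + d * (L - M)))).
  { apply exp_le_mono. unfold m in HMt. nra. }
  assert (exp (M + - (t / 2) + (d - 1) * L) <= exp (k + (- L - M + d * (L - M)))).
  { apply exp_le_mono. unfold m in HMt. nra. }
  lra.
Qed.

Lemma gamma_majorant c :
  0 < dRe c -> exists d K, 0 < d /\ 0 < K /\ forall t, 0 < t ->
    (1 + t) * exp (- (t / 2)) * dabs (Rdpower t (c - RtoD 1)) <= K * maj d t.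
Proof.
  intros Hc. set (d := dRe c / 2).
  assert (Hd : 0 < d) by (unfold d; lra).
  destruct (exp_decay_le_maj d Hd) as [K [HK H]].
  set (k := 1 + Rabs (dDu (c - RtoD 1)) / d).
  assert (Hk : 0 < k).
  { unfold k. pose proof (Rdiv_le_0_compat _ _ (Rabs_pos (dDu (c - RtoD 1))) Hd). lra. }
  exists d, (k * K). split; [easy|split; [nra|]]. intros t Ht.
  specialize (H t Ht). pose proof (dabs_Rdpower_le d (c - RtoD 1) t Hd) as H'. fold k in H'.
  replace (dRe (c - RtoD 1) + d) with (3 * d - 1) in H' by (unfold d; cbn; lra).
  replace (dRe (c - RtoD 1) - d) with (d - 1) in H' by (unfold d; cbn; lra).
  assert (0 < (1 + t) * exp (- (t / 2))).
  { pose proof (exp_pos (- (t / 2))). nra. }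
  apply Rmult_le_compat_l with (r := (1 + t) * exp (- (t / 2))) in H'; [|lra]. nra.
Qed.

Lemma dderive_dgamma_integrand c t :
  0 < t -> exists l, dderive (dgamma_integrand c) t l.
Proof.
  intros Ht. eexists. apply (dderive_mul (fun t => RtoD (exp (- t))) (fun t => Rdpower t (c - RtoD 1))).
  - apply (dderive_RtoD (fun t => exp (- t)) t (- exp (- t))). auto_derive; [easy|ring].
  - apply (dderive_Rdpower (fun t => t) t 1); [easy|]. apply (is_derive_id (K := R_AbsRing)).
Qed.

Lemma dGamma_primitive c :
  0 < dRe c -> exists P, dprimitive 0 p_infty (dgamma_integrand c) P /\
    dlim (at_right 0) P (RtoD 0) /\ dlim (Rbar_locally p_infty) P (dGamma c).
Proof.
  intros Hc. destruct (gamma_majorant c Hc) as (d & K & Hd & HK & H).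
  assert (Hf : dderivable 0 p_infty (dgamma_integrand c)).
  { intros t Ht _. now apply dderive_dgamma_integrand. }
  destruct (dprimitive_dominated (dgamma_integrand c) d K) as (P & v & HP & H0 & Hv & _); try easy.
  { intros t Ht. apply Rle_trans with (2 := H t Ht). unfold dgamma_integrand.
    rewrite dabs_mul_RtoD, Rabs_pos_eq by (left; apply exp_pos).
    apply Rmult_le_compat_r; [apply dabs_pos|].
    assert (exp (- t) <= exp (- (t / 2))) by (apply exp_le_mono; lra).
    pose proof (exp_pos (- (t / 2))). nra. }
  exists P. split; [easy|split; [easy|]].
  replace (dGamma c) with v; [easy|].
  destruct (is_RInt_gen_dprimitive 0 p_infty (at_right 0) (Rbar_locally p_infty)
              (at_right_Ioi 0) (p_infty_Ioi 0) _ P _ _ HP Hf H0 Hv) as [H1 H2].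
  apply dual_ext; symmetry; unfold dGamma, dRe at 1, dDu at 1; cbn [fst snd].
  - rewrite (is_RInt_gen_unique _ _ H1). cbn. ring.
  - rewrite (is_RInt_gen_unique _ _ H2). cbn. ring.
Qed.

Lemma dRe_dGamma_pos c : 0 < dRe c -> 0 < dRe (dGamma c).
Proof.
  intros Hc. destruct (dGamma_primitive c Hc) as (P & HP & [H0 _] & [Hv _]).
  assert (Hinc : forall x y, 0 < x -> x < y -> dRe (P x) < dRe (P y)).
  { intros x y Hx Hxy.
    apply (incr_function (fun t => dRe (P t)) 0 p_infty (fun t => dRe (dgamma_integrand c t))); try easy.
    - intros t Ht1 Ht2. apply HP; easy.
    - intros t Ht1 Ht2. unfold dgamma_integrand. rewrite dRe_mul.
      apply Rmult_lt_0_compat; [apply exp_pos|apply dRe_Rdpower_pos]. }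
  assert (A : 0 <= dRe (P 1)).
  { apply (filterlim_le (F := at_right 0) (fun t => dRe (P t)) (fun _ => dRe (P 1))
             (Finite 0) (Finite (dRe (P 1)))); [|easy|apply filterlim_const].
    apply filter_imp with (2 := at_right_Ioo 0 1 Rlt_0_1). intros t [Ht1 Ht2].
    left. now apply Hinc. }
  assert (B : dRe (P 2) <= dRe (dGamma c)).
  { apply (filterlim_le (F := Rbar_locally p_infty) (fun _ => dRe (P 2)) (fun t => dRe (P t))
             (Finite (dRe (P 2))) (Finite (dRe (dGamma c)))); [|apply filterlim_const|easy].
    exists 2. intros t Ht. left. apply Hinc; lra. }
  pose proof (Hinc 1 2 ltac:(lra) ltac:(lra)). lra.
Qed.

(** * The dual beta integral *)

Definition betaf (z c : dual) (u : R) : dual :=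
  (Rdpower u (z - RtoD 1) * Rdpower (1 - u) (c - RtoD 1))%D.

(** Encoded by a primitive vanishing at 0, on which integration by parts and
    changes of variable act directly. *)
Definition is_dbeta (z c v : dual) : Prop :=
  exists P, dprimitive 0 1 (betaf z c) P /\
    dlim (at_right 0) P (RtoD 0) /\ dlim (at_left 1) P v.

Lemma dderive_continuous f x l : dderive f x l -> dlim (locally x) f (f x).
Proof.
  intros [H1 H2]; split.
  - apply (ex_derive_continuous (V := R_NormedModule) (fun t => dRe (f t))). now exists (dRe l).
  - apply (ex_derive_continuous (V := R_NormedModule) (fun t => dDu (f t))). now exists (dDu l).
Qed.

Lemma dlim_Rdpower_0 c : 0 < dRe c -> dlim (at_right 0) (fun t => Rdpower t c) (RtoD 0).
Proof.
  intros Hc. set (d := dRe c / 2). assert (Hd : 0 < d) by (unfold d; lra).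
  apply dlim_squeeze with
    (fun t => (1 + Rabs (dDu c) / d) * (Rpower t (dRe c + d) + Rpower t (dRe c - d))).
  - apply filter_forall. intros t.
    replace (Rdpower t c - RtoD 0)%D with (Rdpower t c) by ring. now apply dabs_Rdpower_le.
  - replace (locally 0) with (locally ((1 + Rabs (dDu c) / d) * (0 + 0))) by (f_equal; ring).
    apply filterlim_Rmult_2; [apply filterlim_const|].
    apply filterlim_Rplus_2; apply filterlim_Rpower_0; unfold d; lra.
Qed.

Lemma dlim_Rdpower_1 c : dlim (locally 1) (fun t => Rdpower t c) (RtoD 1).
Proof.
  rewrite <- (Rdpower_1_l c).
  eapply (dderive_continuous (fun t => Rdpower t c)), (dderive_Rdpower (fun t => t) 1 1); [lra|].
  apply (is_derive_id (K := R_AbsRing)).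
Qed.

Lemma filterlim_flip_0 : filterlim (fun u => 1 - u) (at_right 0) (at_left 1).
Proof.
  intros Q [eps HQ]. exists eps. intros u Hu H. apply HQ; [|lra].
  apply Rabs_lt_between' in Hu. apply Rabs_lt_between'. lra.
Qed.

Lemma filterlim_flip_1 : filterlim (fun u => 1 - u) (at_left 1) (at_right 0).
Proof.
  intros Q [eps HQ]. exists eps. intros u Hu H. apply HQ; [|lra].
  apply Rabs_lt_between' in Hu. apply Rabs_lt_between'. lra.
Qed.

Lemma at_left_locally x Q : locally x Q -> at_left x Q.
Proof. apply filter_le_within. Qed.

Lemma at_right_locally x Q : locally x Q -> at_right x Q.
Proof. apply filter_le_within. Qed.

Lemma dlim_Rdpower_left c : dlim (at_left 1) (fun t => Rdpower t c) (RtoD 1).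
Proof.
  refine (dlim_comp _ _ (fun t => t) _ _ _ (dlim_Rdpower_1 c)). exact (at_left_locally 1).
Qed.

Lemma dlim_Rdpower_flip_0 c : dlim (at_right 0) (fun t => Rdpower (1 - t) c) (RtoD 1).
Proof. exact (dlim_comp _ _ _ _ _ filterlim_flip_0 (dlim_Rdpower_left c)). Qed.

Lemma dlim_Rdpower_flip_1 c :
  0 < dRe c -> dlim (at_left 1) (fun t => Rdpower (1 - t) c) (RtoD 0).
Proof. intros Hc. exact (dlim_comp _ _ _ _ _ filterlim_flip_1 (dlim_Rdpower_0 c Hc)). Qed.

Lemma dderive_Rdpower_id u c :
  0 < u -> dderive (fun t => Rdpower t c) u (c * Rdpower u (c - RtoD 1))%D.
Proof.
  intros Hu. replace (c * Rdpower u (c - RtoD 1))%D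
    with (RtoD 1 * c * Rdpower u (c - RtoD 1))%D by ring.
  apply (dderive_Rdpower (fun t => t)); [easy|]. apply (is_derive_id (K := R_AbsRing)).
Qed.

Lemma dderive_Rdpower_flip u c :
  u < 1 -> dderive (fun t => Rdpower (1 - t) c) u (- (c * Rdpower (1 - u) (c - RtoD 1)))%D.
Proof.
  intros Hu. replace (- (c * Rdpower (1 - u) (c - RtoD 1)))%D
    with (RtoD (Ropp 1) * c * Rdpower (1 - u) (c - RtoD 1))%D by (rewrite RtoD_opp; ring).
  apply (dderive_Rdpower (fun t => 1 - t)); [lra|]. auto_derive; [easy|ring].
Qed.

Lemma dderivable_betaf z c : dderivable 0 1 (betaf z c).
Proof.
  intros u Hu1 Hu2. eexists. apply dderive_mul.
  - now apply dderive_Rdpower_id.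
  - now apply dderive_Rdpower_flip.
Qed.

Lemma is_dbeta_unique z c v w : is_dbeta z c v -> is_dbeta z c w -> v = w.
Proof.
  intros (P & HP & P0 & P1) (Q & HQ & Q0 & Q1).
  set (k := (P (/ 2)%R - Q (/ 2)%R)%D).
  assert (Hk : forall u, 0 < u -> u < 1 -> k = (P u - Q u)%D).
  { intros u Hu1 Hu2. unfold k.
    apply (dderive_0_const 0 1 (fun t => P t - Q t)%D); cbn; try lra.
    intros x Hx1 Hx2. replace (RtoD 0) with (betaf z c x - betaf z c x)%D by ring.
    apply dderive_sub; [now apply HP|now apply HQ]. }
  assert (K0 : k = (RtoD 0 - RtoD 0)%D).
  { apply (dlim_unique (F := at_right 0) (fun _ => k)); [apply dlim_const|].
    apply dlim_ext_loc with (fun u => P u - Q u)%D; [|now apply dlim_sub].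
    apply filter_imp with (2 := at_right_Ioo 0 1 Rlt_0_1). intros u [H1 H2]. symmetry. now apply Hk. }
  assert (K1 : k = (v - w)%D).
  { apply (dlim_unique (F := at_left 1) (fun _ => k)); [apply dlim_const|].
    apply dlim_ext_loc with (fun u => P u - Q u)%D; [|now apply dlim_sub].
    apply filter_imp with (2 := at_left_Ioo 0 1 Rlt_0_1). intros u [H1 H2]. symmetry. now apply Hk. }
  replace v with ((v - w) + w)%D by ring. rewrite <- K1, K0. ring.
Qed.

Section Beta_recursion.
Context (z c : dual).
Hypothesis (Hz : 0 < dRe z) (Hc : 0 < dRe c).

Let bdry (u : R) : dual := (Rdpower u z * Rdpower (1 - u) c)%D.

(** Integration by parts for [B]: [bdry] vanishes at both ends. *)
Lemma dderive_beta_boundary u :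
  0 < u -> u < 1 ->
  dderive bdry u (z * betaf z c u - (z + c) * betaf (z + RtoD 1) c u)%D.
Proof.
  intros Hu1 Hu2.
  replace (z * betaf z c u - (z + c) * betaf (z + RtoD 1) c u)%D with
    (z * Rdpower u (z - RtoD 1) * Rdpower (1 - u) c
      + Rdpower u z * - (c * Rdpower (1 - u) (c - RtoD 1)))%D.
  - apply dderive_mul; [now apply dderive_Rdpower_id|now apply dderive_Rdpower_flip].
  - unfold betaf. replace (z + RtoD 1 - RtoD 1)%D with z by ring.
    rewrite <- (Rdpower_pred u z), <- (Rdpower_pred (1 - u) c), RtoD_sub by lra. ring.
Qed.

Lemma dlim_beta_boundary_0 : dlim (at_right 0) bdry (RtoD 0).
Proof.
  replace (RtoD 0) with (RtoD 0 * RtoD 1)%D by ring.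
  apply dlim_mul; [now apply dlim_Rdpower_0|apply dlim_Rdpower_flip_0].
Qed.

Lemma dlim_beta_boundary_1 : dlim (at_left 1) bdry (RtoD 0).
Proof.
  replace (RtoD 0) with (RtoD 1 * RtoD 0)%D by ring.
  apply dlim_mul; [apply dlim_Rdpower_left|now apply dlim_Rdpower_flip_1].
Qed.

Lemma dRe_add_neq_0 : dRe (z + c)%D <> 0.
Proof. cbn. unfold dRe in *. lra. Qed.

Lemma is_dbeta_incr v : is_dbeta z c v -> is_dbeta (z + RtoD 1) c (z * v / (z + c))%D.
Proof.
  intros (P & HP & P0 & P1).
  exists (fun u => dinv (z + c) * (z * P u - bdry u))%D. split; [|split].
  - intros u Hu1 Hu2.
    replace (betaf (z + RtoD 1) c u) with (dinv (z + c) *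
      (z * betaf z c u - (z * betaf z c u - (z + c) * betaf (z + RtoD 1) c u)))%D.
    + apply dderive_scal, dderive_sub; [apply dderive_scal; now apply HP|].
      now apply dderive_beta_boundary.
    + transitivity ((z + c) * dinv (z + c) * betaf (z + RtoD 1) c u)%D; [ring|].
      rewrite dinv_r by apply dRe_add_neq_0. ring.
  - replace (RtoD 0) with (dinv (z + c) * (z * RtoD 0 - RtoD 0))%D by ring.
    apply dlim_mul; [apply dlim_const|]. apply dlim_sub; [|apply dlim_beta_boundary_0].
    apply dlim_mul; [apply dlim_const|easy].
  - replace (z * v / (z + c))%D with (dinv (z + c) * (z * v - RtoD 0))%D by (unfold ddiv; ring).
    apply dlim_mul; [apply dlim_const|]. apply dlim_sub; [|apply dlim_beta_boundary_1].
    apply dlim_mul; [apply dlim_const|easy].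
Qed.

Lemma is_dbeta_decr v : is_dbeta (z + RtoD 1) c v -> is_dbeta z c ((z + c) * v / z)%D.
Proof.
  intros (P & HP & P0 & P1).
  exists (fun u => dinv z * ((z + c) * P u + bdry u))%D. split; [|split].
  - intros u Hu1 Hu2.
    replace (betaf z c u) with (dinv z * ((z + c) * betaf (z + RtoD 1) c u +
      (z * betaf z c u - (z + c) * betaf (z + RtoD 1) c u)))%D.
    + apply dderive_scal, dderive_add; [apply dderive_scal; now apply HP|].
      now apply dderive_beta_boundary.
    + transitivity (z * dinv z * betaf z c u)%D; [ring|].
      rewrite dinv_r by lra. ring.
  - replace (RtoD 0) with (dinv z * ((z + c) * RtoD 0 + RtoD 0))%D by ring.
    apply dlim_mul; [apply dlim_const|]. apply dlim_add; [|apply dlim_beta_boundary_0].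
    apply dlim_mul; [apply dlim_const|easy].
  - replace ((z + c) * v / z)%D with (dinv z * ((z + c) * v + RtoD 0))%D by (unfold ddiv; ring).
    apply dlim_mul; [apply dlim_const|]. apply dlim_add; [|apply dlim_beta_boundary_1].
    apply dlim_mul; [apply dlim_const|easy].
Qed.
End Beta_recursion.

(** * From the beta to the gamma function *)

(** The factor by which [1 - e^(-y)] falls short of [y]. *)
Definition expdefect (y : R) : R := (1 - exp (- y)) / y.

Lemma expdefect_bounds y : 0 < y -> exp (- y) <= expdefect y <= 1.
Proof.
  intros Hy. unfold expdefect.
  pose proof (exp_ineq1_le (- y)). pose proof (exp_ineq1_le y).
  pose proof (exp_pos (- y)).
  assert (exp y * exp (- y) = 1) by (rewrite <- exp_plus, Rplus_opp_r; apply exp_0).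
  split; [apply Rle_div_r|apply Rle_div_l]; nra.
Qed.

Lemma Rabs_ln_expdefect y : 0 < y -> Rabs (ln (expdefect y)) <= y.
Proof.
  intros Hy. destruct (expdefect_bounds y Hy) as [H1 H2].
  pose proof (exp_pos (- y)).
  assert (ln (expdefect y) <= 0) by (rewrite <- ln_1; apply ln_le; lra).
  assert (- y <= ln (expdefect y)) by (rewrite <- (ln_exp (- y)); apply ln_le; lra).
  apply Rabs_le. lra.
Qed.

(** Under [u = e^(-t/n)] the integrand of [n^c B(a + n, c)] becomes the gamma
    integrand times the exponential of this quantity, which is [O(t/n)]. *)
Definition beta_defect (a c : dual) (y : R) : dual :=
  (RtoD (- y) * a + RtoD (ln (expdefect y)) * (c - RtoD 1))%D.

Lemma dabs_beta_defect a c y :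
  0 < y -> dabs (beta_defect a c y) <= (dabs a + dabs (c - RtoD 1)) * y.
Proof.
  intros Hy. apply (Rle_trans _ _ _ (dabs_add _ _)). rewrite !dabs_mul_RtoD.
  rewrite Rabs_Ropp, Rabs_pos_eq by lra.
  pose proof (Rabs_ln_expdefect y Hy). pose proof (dabs_pos (c - RtoD 1)). nra.
Qed.

Lemma beta_substitution a c n u :
  0 < n -> 0 < u -> u < 1 ->
  betaf (a + RtoD n) c u =
    (Rdpower n (- c) * (RtoD (n / u) * (dgamma_integrand c (- n * ln u)
       * dexp (beta_defect a c (- n * ln u / n)))))%D.
Proof.
  intros Hn Hu1 Hu2.
  assert (Hln : ln u < 0) by (rewrite <- ln_1; now apply ln_increasing).
  assert (Ey : - n * ln u / n = - ln u) by (field; lra). rewrite Ey.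
  set (t := - n * ln u). assert (Ht : 0 < t) by (unfold t; nra).
  assert (Edef : t * expdefect (- ln u) = n * (1 - u)).
  { unfold expdefect, t. rewrite Ropp_involutive, exp_ln by easy. field. lra. }
  assert (Hdef : 0 < expdefect (- ln u)).
  { apply Rmult_lt_reg_l with t; [easy|]. rewrite Edef. nra. }
  unfold beta_defect, dgamma_integrand. rewrite dexp_add, <- Rdpower_dexp, Ropp_involutive.
  rewrite <- Rdpower_dexp.
  transitivity (Rdpower n (- c) * (RtoD (n / u) * (RtoD (exp (- t)) *
      (Rdpower t (c - RtoD 1) * Rdpower (expdefect (- ln u)) (c - RtoD 1)) * Rdpower u a)))%D;
    [|ring].
  rewrite <- Rdpower_mult, Edef, Rdpower_mult by lra.
  unfold betaf. replace (a + RtoD n - RtoD 1)%D with (a + (RtoD n - RtoD 1))%D by ring.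
  rewrite Rdpower_add, <- RtoD_sub, Rdpower_RtoD.
  assert (E : RtoD (Rpower u (n - 1)) = (RtoD (/ u) * RtoD (exp (- t)))%D).
  { rewrite <- RtoD_mul. f_equal. unfold Rpower, t.
    replace ((n - 1) * ln u) with (- ln u + - (- n * ln u)) by ring.
    rewrite exp_plus, exp_Ropp, exp_ln by easy. reflexivity. }
  rewrite E. unfold Rdiv. rewrite RtoD_mul.
  transitivity (Rdpower n (- c) * (RtoD n * Rdpower n (c - RtoD 1)) *
     (Rdpower u a * (RtoD (/ u) * RtoD (exp (- t))) * Rdpower (1 - u) (c - RtoD 1)))%D; [|ring].
  rewrite Rdpower_pred by easy.
  replace (Rdpower n (- c) * Rdpower n c)%D with (Rdpower n c * Rdpower n (- c))%D by ring.
  rewrite Rdpower_opp. ring.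
Qed.

Lemma dderive_beta_defect a c n t :
  0 < n -> 0 < t -> exists l, dderive (fun t => beta_defect a c (t / n)) t l.
Proof.
  intros Hn Ht. assert (Hy : 0 < t / n) by now apply Rdiv_lt_0_compat.
  destruct (expdefect_bounds _ Hy) as [H1 _]. pose proof (exp_pos (- (t / n))).
  assert (Hl : ex_derive (fun t => ln (expdefect (t / n))) t).
  { unfold expdefect in *. auto_derive. split; [apply Rgt_not_eq; lra|split; [|lra]].
    unfold Rdiv in *. lra. }
  destruct Hl as [l Hl]. eexists. unfold beta_defect. apply dderive_add; apply dderive_mul.
  - apply (dderive_RtoD (fun t => - (t / n)) t (- / n)). auto_derive; [lra|field; lra].
  - apply dderive_const.
  - apply (dderive_RtoD _ _ _ Hl).
  - apply dderive_const.
Qed.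

(** [n^c B(a + n, c)] tends to [Gamma c] at rate [1/n]: the two integrands over
    the half-line differ by at most [(A t/n) e^(t/2)] times the gamma integrand
    once [n >= 2 A]. *)
Lemma is_dbeta_scaled a c :
  0 < dRe c -> exists n0 K, 0 < n0 /\ forall n, n0 <= n ->
    exists V, is_dbeta (a + RtoD n) c (Rdpower n (- c) * V) /\
              dabs (V - dGamma c) <= K / n.
Proof.
  intros Hc.
  destruct (gamma_majorant c Hc) as (d & K & Hd & HK & Hmaj).
  destruct (dGamma_primitive c Hc) as (G & HG & G0 & G1).
  set (A := dabs a + dabs (c - RtoD 1) + 1).
  assert (HA : 1 <= A).
  { unfold A. pose proof (dabs_pos a). pose proof (dabs_pos (c - RtoD 1)). lra. }
  exists (2 * A), (2 * (A * K)). split; [lra|]. intros n Hn.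
  set (h := fun t => (dgamma_integrand c t * (dexp (beta_defect a c (t / n)) - RtoD 1))%D).
  destruct (dprimitive_dominated h d (A * K / n)) as (P & v & HP & P0 & P1 & Hv); [easy| | | |].
  { apply Rdiv_lt_0_compat; [nra|lra]. }
  { intros t Ht _.
    destruct (dderive_dgamma_integrand c t Ht) as [l1 H1].
    destruct (dderive_beta_defect a c n t ltac:(lra) Ht) as [l2 H2].
    eexists. apply dderive_mul; [exact H1|].
    apply dderive_sub; [apply dderive_dexp; exact H2|apply dderive_const]. }
  { intros t Ht. assert (Hy : 0 < t / n) by (apply Rdiv_lt_0_compat; lra).
    assert (Hw : dabs (beta_defect a c (t / n)) <= A * (t / n)).
    { apply (Rle_trans _ _ _ (dabs_beta_defect a c _ Hy)). unfold A. lra. }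
    assert (Hhalf : A * (t / n) <= t / 2).
    { apply Rmult_le_reg_r with n; [lra|]. field_simplify; [|lra]. nra. }
    unfold h, dgamma_integrand.
    apply (Rle_trans _ _ _ (dabs_mul _ _)).
    rewrite dabs_mul_RtoD, Rabs_pos_eq by (left; apply exp_pos).
    assert (Hd1 : dabs (dexp (beta_defect a c (t / n)) - RtoD 1) <= A / n * (t * exp (t / 2))).
    { apply (Rle_trans _ _ _ (dabs_dexp_sub_1 _)).
      apply Rle_trans with (A * (t / n) * exp (t / 2)); [|right; field; lra].
      apply Rmult_le_compat; [apply dabs_pos|left; apply exp_pos|easy|apply exp_le_mono; lra]. }
    specialize (Hmaj t Ht). set (r := dabs (Rdpower t (c - RtoD 1))) in *.
    assert (Hr : 0 <= r) by apply dabs_pos.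
    assert (HAn : 0 < A / n) by (apply Rdiv_lt_0_compat; lra).
    apply Rle_trans with (exp (- t) * r * (A / n * (t * exp (t / 2)))).
    { apply Rmult_le_compat_l; [|easy]. apply Rmult_le_pos; [left; apply exp_pos|easy]. }
    replace (exp (- t)) with (exp (- (t / 2)) * exp (- (t / 2))) by (rewrite <- exp_plus; f_equal; field).
    assert (Ee : exp (- (t / 2)) * exp (t / 2) = 1) by (rewrite <- exp_plus, Rplus_opp_l; apply exp_0).
    replace (exp (- (t / 2)) * exp (- (t / 2)) * r * (A / n * (t * exp (t / 2))))
      with (A / n * (t * exp (- (t / 2)) * r) * (exp (- (t / 2)) * exp (t / 2))) by ring.
    rewrite Ee, Rmult_1_r.
    replace (A * K / n * maj d t) with (A / n * (K * maj d t)) by (field; lra).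
    apply Rmult_le_compat_l; [lra|]. apply Rle_trans with (2 := Hmaj).
    pose proof (exp_pos (- (t / 2))). apply Rmult_le_compat_r; [easy|]. nra. }
  exists (dGamma c + v)%D. split.
  2:{ replace (dGamma c + v - dGamma c)%D with v by ring.
      apply (Rle_trans _ _ _ Hv). right. field. lra. }
  set (p := fun u => - n * ln u).
  exists (fun u => Rdpower n (- c) * ((dGamma c + v) - (G (p u) + P (p u))))%D.
  assert (Hp0 : filterlim p (at_right 0) (Rbar_locally p_infty)).
  { apply (filterlim_comp _ _ _ _ _ _ _ _ is_lim_ln_0).
    replace p_infty with (Rbar_mult (- n) m_infty); [apply (filterlim_Rbar_mult_l (- n) m_infty)|].
    apply is_Rbar_mult_unique, is_Rbar_mult_sym, is_Rbar_mult_m_infty_neg. cbn. lra. }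
  assert (Hp1 : filterlim p (at_left 1) (at_right 0)).
  { assert (Hc1 : filterlim p (at_left 1) (locally 0)).
    { replace 0 with (p 1) by (unfold p; rewrite ln_1; ring).
      refine (filterlim_filter_le_1 _ (at_left_locally 1) _).
      apply (ex_derive_continuous (V := R_NormedModule) p). unfold p. auto_derive. lra. }
    intros Q HQ. unfold at_right, within in HQ. specialize (Hc1 _ HQ).
    unfold filtermap in *.
    refine (filter_imp _ _ _ (filter_and _ _ Hc1 (at_left_Ioo 0 1 Rlt_0_1))).
    intros u [H1 [Hu1 Hu2]]. cbn in Hu1, Hu2. apply H1. unfold p.
    assert (ln u < 0) by (rewrite <- ln_1; now apply ln_increasing). nra. }
  split; [|split].
  - intros u Hu1 Hu2. cbn in Hu1, Hu2.
    assert (Hpu : 0 < p u).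
    { unfold p. assert (ln u < 0) by (rewrite <- ln_1; now apply ln_increasing). nra. }
    rewrite beta_substitution by lra. fold (p u).
    apply dderive_scal.
    assert (Ef : (RtoD (n / u) * (dgamma_integrand c (p u) * dexp (beta_defect a c (p u / n))))%D
        = (RtoD 0 - RtoD (- (n / u)) * (dgamma_integrand c (p u) + h (p u)))%D)
      by (unfold h; rewrite RtoD_opp; ring).
    rewrite Ef. apply dderive_sub; [apply dderive_const|].
    apply (dderive_comp (fun t => G t + P t)%D).
    + apply dderive_add; [now apply HG|now apply HP].
    + unfold p. auto_derive; [easy|]. field. lra.
  - replace (RtoD 0) with (Rdpower n (- c) * ((dGamma c + v) - (dGamma c + v)))%D by ring.
    apply dlim_mul; [apply dlim_const|]. apply dlim_sub; [apply dlim_const|].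
    apply (dlim_comp _ _ p (fun t => G t + P t)%D _ Hp0). now apply dlim_add.
  - replace (Rdpower n (- c) * (dGamma c + v))%D
      with (Rdpower n (- c) * ((dGamma c + v) - (RtoD 0 + RtoD 0)))%D by ring.
    apply dlim_mul; [apply dlim_const|]. apply dlim_sub; [apply dlim_const|].
    apply (dlim_comp _ _ p (fun t => G t + P t)%D _ Hp1). now apply dlim_add.
Qed.

Lemma RtoD_S n : RtoD (INR (S n)) = (RtoD (INR n) + RtoD 1)%D.
Proof. rewrite S_INR. apply RtoD_add. Qed.

(** For large [n] the parameter [z + n] is covered by [is_dbeta_scaled]; the
    recursion brings it back to [z]. *)
Lemma is_dbeta_ex z c : 0 < dRe z -> 0 < dRe c -> exists v, is_dbeta z c v.
Proof.
  intros Hz Hc. destruct (is_dbeta_scaled z c Hc) as (n0 & K & Hn0 & H).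
  destruct (INR_unbounded n0) as [n Hn].
  destruct (H (INR n)) as [V [HV _]]; [lra|]. clear H.
  assert (Hw : exists v, is_dbeta (z + RtoD (INR n)) c v) by (eexists; exact HV).
  clear Hn HV. induction n as [|n IH].
  - now replace z with (z + RtoD (INR 0))%D by (cbn [INR]; ring).
  - apply IH. destruct Hw as [w Hw]. eexists. apply is_dbeta_decr; [|easy|].
    + cbn. pose proof (pos_INR n). unfold dRe in *. lra.
    + replace (z + RtoD (INR n) + RtoD 1)%D with (z + RtoD (INR (S n)))%D
        by (rewrite RtoD_S; ring). exact Hw.
Qed.

Lemma dpoch_S a n : dpoch a (S n) = (dpoch a n * (a + RtoD (INR n)))%D.
Proof. reflexivity. Qed.

Lemma dpoch_shift a n : dpoch a (S n) = (a * dpoch (a + RtoD 1) n)%D.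
Proof.
  induction n as [|n IH].
  - cbn [dpoch INR]. ring.
  - rewrite dpoch_S, IH, dpoch_S, RtoD_S. ring.
Qed.

Lemma dpoch_1 n : dpoch (RtoD 1) n = RtoD (INR (fact n)).
Proof.
  induction n as [|n IH]; [reflexivity|].
  rewrite dpoch_S, IH, <- RtoD_add, <- RtoD_mul. f_equal.
  rewrite fact_simpl, mult_INR, S_INR. ring.
Qed.

Lemma dRe_dpoch_neq_0 a : (forall n, dRe a <> - INR n) -> forall n, dRe (dpoch a n) <> 0.
Proof.
  intros Ha n. induction n as [|n IH]; [exact R1_neq_R0|].
  rewrite dpoch_S, dRe_mul. apply Rmult_integral_contrapositive_currified; [easy|].
  specialize (Ha n). cbn. unfold dRe in *. lra.
Qed.

Lemma dRe_pos_not_pole a : 0 < dRe a -> forall n, dRe a <> - INR n.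
Proof. intros Ha n. pose proof (pos_INR n). lra. Qed.

Lemma dRe_shift_pos a n : 0 < dRe a -> 0 < dRe (a + RtoD (INR n)).
Proof. intros Ha. pose proof (pos_INR n). cbn. unfold dRe in *. lra. Qed.

Lemma is_dbeta_dpoch z c v n :
  0 < dRe z -> 0 < dRe c -> is_dbeta z c v ->
  is_dbeta (z + RtoD (INR n)) c (v * (dpoch z n / dpoch (z + c) n))%D.
Proof.
  intros Hz Hc Hv. assert (Hzc : 0 < dRe (z + c)) by (cbn; unfold dRe in *; lra).
  assert (Hp := dRe_dpoch_neq_0 _ (dRe_pos_not_pole _ Hzc)).
  induction n as [|n IH].
  - replace (z + RtoD (INR 0))%D with z by (cbn [INR]; ring).
    replace (v * (dpoch z 0 / dpoch (z + c) 0))%D with v; [easy|].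
    cbn [dpoch]. rewrite (ddiv_eq _ _ (RtoD 1)); [ring|exact R1_neq_R0|ring].
  - apply is_dbeta_incr in IH; [|now apply dRe_shift_pos|easy].
    replace (z + RtoD (INR (S n)))%D with (z + RtoD (INR n) + RtoD 1)%D by (rewrite RtoD_S; ring).
    replace (v * (dpoch z (S n) / dpoch (z + c) (S n)))%D with
      ((z + RtoD (INR n)) * (v * (dpoch z n / dpoch (z + c) n)) / (z + RtoD (INR n) + c))%D; [easy|].
    apply ddiv_eq.
    + apply Rgt_not_eq. replace (z + RtoD (INR n) + c)%D with (z + c + RtoD (INR n))%D by ring.
      now apply dRe_shift_pos.
    + apply (dmul_cancel_l (dpoch (z + c) n)); [apply Hp|].
      transitivity ((z + RtoD (INR n)) * v * (dpoch (z + c) n * (dpoch z n / dpoch (z + c) n)))%D; [ring|].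
      rewrite dmul_div by apply Hp.
      transitivity (v * (dpoch (z + c) (S n) * (dpoch z (S n) / dpoch (z + c) (S n))))%D;
        [|rewrite dpoch_S; ring].
      rewrite dmul_div by apply Hp. rewrite dpoch_S. ring.
Qed.

Lemma filterlim_inv_INR_S K : filterlim (fun n => K / INR (S n)) eventually (locally 0).
Proof.
  replace (locally 0) with (locally (K * 0)) by (f_equal; ring).
  apply (filterlim_Rmult_2 (fun _ => K)); [apply filterlim_const|].
  apply (is_lim_seq_inv (fun n => INR (S n)) p_infty); [|easy].
  apply (is_lim_seq_incr_1 INR), is_lim_seq_INR.
Qed.

Lemma dlim_beta_dpoch a c v :
  0 < dRe a -> 0 < dRe c -> is_dbeta a c v ->
  dlim eventually
    (fun n => Rdpower (INR (S n)) c * (v * (dpoch a n / dpoch (a + c) n)))%D (dGamma c).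
Proof.
  intros Ha Hc Hv.
  (* shifting by one turns the parameter [a + n] into [(a - 1) + (n + 1)] *)
  destruct (is_dbeta_scaled (a - RtoD 1) c Hc) as (n0 & K & Hn0 & H).
  apply dlim_squeeze with (fun n => K / INR (S n)); [|apply filterlim_inv_INR_S].
  destruct (INR_unbounded n0) as [N HN]. exists N. intros n Hn.
  destruct (H (INR (S n))) as [V [HV HVK]].
  { apply le_INR in Hn. rewrite S_INR. lra. }
  replace (a - RtoD 1 + RtoD (INR (S n)))%D with (a + RtoD (INR n))%D in HV
    by (rewrite RtoD_S; ring).
  rewrite (is_dbeta_unique _ _ _ _ (is_dbeta_dpoch a c v n Ha Hc Hv) HV).
  replace (Rdpower (INR (S n)) c * (Rdpower (INR (S n)) (- c) * V))%D with V; [easy|].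
  transitivity (Rdpower (INR (S n)) c * Rdpower (INR (S n)) (- c) * V)%D; [|ring].
  rewrite Rdpower_opp. ring.
Qed.

Lemma is_dbeta_1 c : 0 < dRe c -> is_dbeta (RtoD 1) c (dinv c).
Proof.
  intros Hc. exists (fun u => dinv c * (RtoD 1 - Rdpower (1 - u) c))%D. split; [|split].
  - intros u Hu1 Hu2. cbn in Hu1, Hu2.
    replace (betaf (RtoD 1) c u) with
      (dinv c * (RtoD 0 - - (c * Rdpower (1 - u) (c - RtoD 1))))%D.
    + apply dderive_scal, dderive_sub; [apply dderive_const|now apply dderive_Rdpower_flip].
    + unfold betaf. replace (RtoD 1 - RtoD 1)%D with (RtoD 0) by ring.
      rewrite Rdpower_RtoD, Rpower_O by easy.
      transitivity (c * dinv c * Rdpower (1 - u) (c - RtoD 1))%D; [ring|].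
      rewrite dinv_r by lra. ring.
  - replace (RtoD 0) with (dinv c * (RtoD 1 - RtoD 1))%D by ring.
    apply dlim_mul; [apply dlim_const|]. apply dlim_sub; [apply dlim_const|].
    apply dlim_Rdpower_flip_0.
  - assert (H : dlim (at_left 1) (fun u => dinv c * (RtoD 1 - Rdpower (1 - u)%R c))%D
        (dinv c * (RtoD 1 - RtoD 0))%D).
    { apply dlim_mul; [apply dlim_const|]. apply dlim_sub; [apply dlim_const|].
      now apply dlim_Rdpower_flip_1. }
    now replace (dinv c * (RtoD 1 - RtoD 0))%D with (dinv c) in H by ring.
Qed.

(** The case [a = 1] of [dlim_beta_dpoch], in which the beta integral is
    elementary. *)
Lemma dlim_Euler c :
  0 < dRe c ->
  dlim eventually
    (fun n => Rdpower (INR (S n)) c * (RtoD (INR (fact n)) / dpoch c (S n)))%D (dGamma c).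
Proof.
  intros Hc.
  apply dlim_ext_loc with (2 := dlim_beta_dpoch (RtoD 1) c _ Rlt_0_1 Hc (is_dbeta_1 c Hc)).
  apply filter_forall. intros n. f_equal. rewrite dpoch_1. symmetry.
  apply ddiv_eq.
  - apply dRe_dpoch_neq_0. now apply dRe_pos_not_pole.
  - rewrite dpoch_shift. replace (RtoD 1 + c)%D with (c + RtoD 1)%D by ring.
    assert (Hp : dRe (dpoch (c + RtoD 1) n) <> 0).
    { apply dRe_dpoch_neq_0, dRe_pos_not_pole. cbn. unfold dRe in *. lra. }
    transitivity (c * dinv c * (dpoch (c + RtoD 1) n
       * (RtoD (INR (fact n)) / dpoch (c + RtoD 1) n)))%D; [|ring].
    rewrite dinv_r, dmul_div by (easy || lra). ring.
Qed.

Lemma dabs_dinv_shift a :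
  0 < dRe a -> exists K, 0 < K /\ forall n, dabs (dinv (a + RtoD (INR n))) <= K / INR (S n).
Proof.
  intros Ha. set (m := Rmin (dRe a) 1).
  assert (Hm : 0 < m) by (unfold m; apply Rmin_case; lra).
  assert (Hm1 : m <= dRe a) by apply Rmin_l. assert (Hm2 : m <= 1) by apply Rmin_r.
  exists (/ m + Rabs (dDu a) / m ^ 2). split.
  { pose proof (Rinv_0_lt_compat m Hm).
    pose proof (Rdiv_le_0_compat (Rabs (dDu a)) (m ^ 2) (Rabs_pos _) ltac:(nra)). lra. }
  intros n. pose proof (pos_INR n) as Hn. rewrite S_INR. set (N := INR n) in *.
  set (y := dRe a + N). assert (Hy : m * (N + 1) <= y) by (unfold y; nra).
  assert (Hy0 : 0 < m * (N + 1)) by nra.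
  replace (dabs (dinv (a + RtoD N))) with (/ y + Rabs (dDu a) / y ^ 2).
  2:{ unfold dabs, dinv. cbn. fold y. unfold dDu, dRe in *. cbn.
      rewrite Rabs_Ropp. rewrite Rabs_div by nra. rewrite Rplus_0_r.
      rewrite (Rabs_pos_eq (/ _)) by (left; apply Rinv_0_lt_compat; lra).
      rewrite (Rabs_pos_eq (_ * _)) by nra. reflexivity. }
  assert (H1 : / y <= / m / (N + 1)).
  { replace (/ m / (N + 1)) with (/ (m * (N + 1))) by (field; nra).
    now apply Rinv_le_contravar. }
  assert (H2 : Rabs (dDu a) / y ^ 2 <= Rabs (dDu a) / m ^ 2 / (N + 1)).
  { replace (Rabs (dDu a) / m ^ 2 / (N + 1)) with (Rabs (dDu a) * / (m ^ 2 * (N + 1))) by (field; nra).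
    apply Rmult_le_compat_l; [apply Rabs_pos|]. apply Rinv_le_contravar; nra. }
  replace ((/ m + Rabs (dDu a) / m ^ 2) / (N + 1))
    with (/ m / (N + 1) + Rabs (dDu a) / m ^ 2 / (N + 1)) by (field; nra).
  lra.
Qed.

Lemma dRe_dinv_pos a : 0 < dRe a -> 0 < dRe (dinv a).
Proof. apply Rinv_0_lt_compat. Qed.

(** The quotient of two Euler limits. *)
Lemma dlim_dpoch_ratio a c :
  0 < dRe a -> 0 < dRe c ->
  dlim eventually (fun n => Rdpower (INR (S n)) c * (dpoch a n / dpoch (a + c) n))%D
    (dGamma (a + c) / dGamma a)%D.
Proof.
  intros Ha Hc. assert (Hb : 0 < dRe (a + c)) by (cbn; unfold dRe in *; lra).
  set (E := fun z n => (Rdpower (INR (S n)) z * (RtoD (INR (fact n)) / dpoch z (S n)))%D).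
  assert (Hlim : dlim eventually (fun n => E (a + c)%D n * dinv (E a n) *
       (RtoD 1 + c * dinv (a + RtoD (INR n))))%D
      (dGamma (a + c) * dinv (dGamma a) * (RtoD 1 + c * RtoD 0))%D).
  { apply dlim_mul; [apply dlim_mul|apply dlim_add].
    - now apply dlim_Euler.
    - apply dlim_inv; [apply Rgt_not_eq; now apply dRe_dGamma_pos|now apply dlim_Euler].
    - apply dlim_const.
    - apply dlim_mul; [apply dlim_const|].
      destruct (dabs_dinv_shift a Ha) as [K [_ HK]].
      apply dlim_squeeze with (fun n => K / INR (S n)); [|apply filterlim_inv_INR_S].
      apply filter_forall. intros n.
      replace (dinv (a + RtoD (INR n)) - RtoD 0)%D with (dinv (a + RtoD (INR n))) by ring. apply HK. }
  replace (dGamma (a + c) / dGamma a)%D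
    with (dGamma (a + c) * dinv (dGamma a) * (RtoD 1 + c * RtoD 0))%D by (unfold ddiv; ring).
  apply dlim_ext_loc with (2 := Hlim). apply filter_forall. intros n.
  assert (Ppos : forall z k, 0 < dRe z -> dRe (dpoch z k) <> 0).
  { intros z k Hz. now apply dRe_dpoch_neq_0, dRe_pos_not_pole. }
  assert (Hfact : dRe (RtoD (INR (fact n))) <> 0) by apply INR_fact_neq_0.
  set (f := RtoD (INR (fact n))) in *. set (r := Rdpower (INR (S n))).
  assert (HE : forall z, 0 < dRe z -> (dpoch z n * (z + RtoD (INR n)) * E z n)%D = (r z * f)%D).
  { intros z Hz. rewrite <- dpoch_S. unfold E. fold f. fold (r z).
    transitivity (r z * (dpoch z (S n) * (f / dpoch z (S n))))%D; [ring|].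
    rewrite dmul_div by now apply Ppos. ring. }
  assert (HEa : dRe (E a n) <> 0).
  { intros H0. assert (HE' := f_equal dRe (HE a Ha)).
    rewrite !dRe_mul, H0, Rmult_0_r in HE'. symmetry in HE'.
    apply Rmult_integral in HE' as [H|H]; [|easy].
    pose proof (dRe_Rdpower_pos (INR (S n)) a). unfold r in H. lra. }
  assert (Han : dRe (a + RtoD (INR n)) <> 0) by (apply Rgt_not_eq; now apply dRe_shift_pos).
  (* clear all denominators *)
  apply (dmul_cancel_l (dpoch a n * (a + RtoD (INR n)) * E a n * dpoch (a + c) n)).
  { rewrite !dRe_mul. repeat first [assumption|now apply Ppos
                   |apply Rmult_integral_contrapositive_currified]. }
  transitivity (dpoch a n * (dpoch (a + c) n *
     ((a + RtoD (INR n)) + (a + RtoD (INR n)) * dinv (a + RtoD (INR n)) * c) * E (a + c)%D n)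
     * (E a n * dinv (E a n)))%D; [ring|].
  rewrite !dinv_r by easy.
  replace (a + RtoD (INR n) + RtoD 1 * c)%D with (a + c + RtoD (INR n))%D by ring.
  rewrite HE by easy.
  transitivity (dpoch a n * (a + RtoD (INR n)) * E a n * r c *
    (dpoch (a + c) n * (dpoch a n / dpoch (a + c) n)))%D; [|ring].
  rewrite dmul_div, HE by auto.
  unfold r. rewrite Rdpower_add. ring.
Qed.

(** [(n+1)^c (a)_n / (a+c)_n] tends to [Gamma (a + c) / Gamma a], and to
    [Gamma c] after multiplication by [v]. *)
Lemma dbeta_dGamma a c v :
  0 < dRe a -> 0 < dRe c -> is_dbeta a c v ->
  (v * dGamma (a + c))%D = (dGamma a * dGamma c)%D.
Proof.
  intros Ha Hc Hv.
  assert (H : (v * (dGamma (a + c) / dGamma a))%D = dGamma c).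
  { apply (dlim_unique (F := eventually) (fun n =>
      Rdpower (INR (S n)) c * (v * (dpoch a n / dpoch (a + c) n)))%D); [|now apply dlim_beta_dpoch].
    apply dlim_ext_loc with (fun n => v * (Rdpower (INR (S n)) c * (dpoch a n / dpoch (a + c) n)))%D.
    - apply filter_forall. intros n. ring.
    - apply dlim_mul; [apply dlim_const|]. now apply dlim_dpoch_ratio. }
  rewrite <- H.
  transitivity (v * (dGamma a * (dGamma (a + c) / dGamma a)))%D; [|ring].
  rewrite dmul_div; [easy|]. apply Rgt_not_eq. now apply dRe_dGamma_pos.
Qed.

(** * Abelian estimates from the binomial series *)

(** The coefficient of [s^k] in [(1 - s)^(-p)]. *)
Definition binc (p : R) (k : nat) : R := dRe (dpoch (RtoD p) k) / INR (fact k).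

Lemma binc_0 p : binc p 0 = 1.
Proof. unfold binc; cbn. field. Qed.

Lemma binc_S p k : INR (S k) * binc p (S k) = (p + INR k) * binc p k.
Proof.
  unfold binc. rewrite dpoch_S, dRe_mul, fact_simpl, mult_INR.
  replace (dRe (RtoD p + RtoD (INR k))) with (p + INR k) by reflexivity.
  field. split; [apply INR_fact_neq_0|]. rewrite S_INR. pose proof (pos_INR k). lra.
Qed.

Lemma binc_pos p k : 0 < p -> 0 < binc p k.
Proof.
  intros Hp. induction k as [|k IH]; [rewrite binc_0; lra|].
  pose proof (pos_INR k). apply Rmult_lt_reg_l with (INR (S k)); [rewrite S_INR; lra|].
  rewrite binc_S, Rmult_0_r. apply Rmult_lt_0_compat; lra.
Qed.

Lemma CV_radius_binc p : 0 < p -> CV_radius (binc p) = 1.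
Proof.
  intros Hp. replace (Finite 1) with (Finite (/ 1)) by (f_equal; field).
  apply CV_radius_finite_DAlembert; [|lra|].
  - intros n. apply Rgt_not_eq. now apply binc_pos.
  - apply is_lim_seq_ext with (fun n => 1 + (p - 1) / INR (S n)).
    + intros n. pose proof (binc_pos p n Hp) as Hq. pose proof (binc_pos p (S n) Hp).
      rewrite Rabs_pos_eq by (left; now apply Rdiv_lt_0_compat).
      apply Rmult_eq_reg_r with (INR (S n) * binc p n).
      2:{ apply Rgt_not_eq, Rmult_lt_0_compat; [|easy]. rewrite S_INR. pose proof (pos_INR n). lra. }
      replace (binc p (S n) / binc p n * (INR (S n) * binc p n))
        with (INR (S n) * binc p (S n)) by (field; lra).
      rewrite binc_S, S_INR. field. pose proof (pos_INR n). lra.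
    + replace (Finite 1) with (Finite (1 + 0)) by (f_equal; ring).
      apply (filterlim_Rplus_2 (fun _ => 1)); [apply filterlim_const|apply filterlim_inv_INR_S].
Qed.

Lemma PS_derive_binc p n :
  PS_derive (binc p) n = PS_plus (PS_scal p (binc p)) (PS_incr_1 (PS_derive (binc p))) n.
Proof.
  unfold PS_derive at 1. rewrite binc_S.
  unfold PS_plus, PS_scal, PS_incr_1, PS_derive, plus, scal, zero; cbn [AbelianMonoid.plus].
  change mult with Rmult. destruct n as [|n]; cbn - [INR].
  - unfold mult; cbn. ring.
  - unfold mult; cbn - [INR]. ring.
Qed.

(** The binomial series: [y = sum binc p k s^k] solves [(1 - s) y' = p y]. *)
Lemma PSeries_binc p s :
  0 < p -> 0 <= s < 1 -> Rpower (1 - s) p * PSeries (binc p) s = 1.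
Proof.
  intros Hp Hs.
  set (f := fun t => Rpower (1 - t) p * PSeries (binc p) t).
  assert (Hrad : forall t, 0 <= t < 1 -> Rbar_lt (Rabs t) (CV_radius (binc p))).
  { intros t Ht. rewrite CV_radius_binc, Rabs_pos_eq by lra. cbn. lra. }
  assert (Hode : forall t, 0 <= t < 1 ->
     (1 - t) * PSeries (PS_derive (binc p)) t = p * PSeries (binc p) t).
  { intros t Ht.
    assert (E : PSeries (PS_derive (binc p)) t =
      p * PSeries (binc p) t + t * PSeries (PS_derive (binc p)) t).
    { rewrite (PSeries_ext _ _ t (PS_derive_binc p)) at 1.
      rewrite PSeries_plus, PSeries_scal, PSeries_incr_1; [easy| |].
      - apply ex_pseries_scal; [apply Rmult_comm|]. apply CV_radius_inside; auto.
      - apply ex_pseries_incr_1, CV_radius_inside. rewrite CV_radius_derive. auto. }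
    lra. }
  assert (Hd : forall t, 0 <= t <= s -> is_derive f t 0).
  { intros t Ht. assert (Ht' : 0 <= t < 1) by lra.
    assert (Hr : is_derive (fun t => Rpower (1 - t) p) t (- p / (1 - t) * Rpower (1 - t) p)).
    { unfold Rpower. auto_derive; [lra|]. unfold Rminus. field. lra. }
    replace 0 with (- p / (1 - t) * Rpower (1 - t) p * PSeries (binc p) t
      + Rpower (1 - t) p * PSeries (PS_derive (binc p)) t).
    - exact (is_derive_Rmult _ _ _ _ _ Hr (is_derive_PSeries _ _ (Hrad t Ht'))).
    - replace (- p / (1 - t) * Rpower (1 - t) p * PSeries (binc p) t)
        with (- (Rpower (1 - t) p / (1 - t)) * (p * PSeries (binc p) t)) by (field; lra).
      rewrite <- Hode by easy. field. lra. }
  change (f s = 1). replace 1 with (f 0).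
  - destruct (Req_dec s 0) as [->|H0]; [easy|].
    symmetry. apply (eq_is_derive (V := R_NormedModule) f 0 s); [exact Hd|lra].
  - unfold f. rewrite PSeries_0, binc_0, Rminus_0_r. unfold Rpower.
    rewrite ln_1, Rmult_0_r, exp_0. ring.
Qed.

(** Polynomial growth is controlled by the binomial coefficients, by Euler's
    limit at a real argument. *)
Lemma Rpower_le_binc p :
  0 < p -> exists K, 0 < K /\ forall n, Rpower (INR (S n)) (p - 1) <= K * binc p n.
Proof.
  intros Hp. destruct (dlim_seq_bounded _ _ (dlim_Euler (RtoD p) Hp)) as [C HC].
  exists (Rabs C * (p + 1) + 1). split.
  { pose proof (Rmult_le_pos (Rabs C) (p + 1) (Rabs_pos C) ltac:(lra)). lra. }
  intros n. specialize (HC n). pose proof (pos_INR n) as Hn. pose proof (binc_pos p n Hp) as Hq.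
  assert (HS : 0 < INR (S n)) by (rewrite S_INR; lra).
  pose proof (Rle_trans _ _ _ (Rle_trans _ _ _ (Rle_abs _) (dabs_Re _)) HC) as H.
  assert (E : dRe (Rdpower (INR (S n)) (RtoD p) * (RtoD (INR (fact n)) / dpoch (RtoD p) (S n)))
     = Rpower (INR (S n)) (p - 1) * (INR (S n) / ((p + INR n) * binc p n))).
  { rewrite dpoch_S. unfold ddiv. rewrite !dRe_mul.
    unfold binc in *. unfold dinv, Rdpower. unfold dRe at 1 2 3; cbn [fst].
    unfold dRe at 1; cbn [fst]. rewrite dRe_mul.
    replace (dRe (RtoD p + RtoD (INR n))) with (p + INR n) by reflexivity.
    set (P := dRe (dpoch (RtoD p) n)) in *.
    unfold Rminus. rewrite Rpower_plus, Rpower_Ropp, Rpower_1 by easy.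
    assert (0 < P).
    { apply Rmult_lt_reg_r with (/ INR (fact n)); [apply Rinv_0_lt_compat, INR_fact_lt_0|].
      rewrite Rmult_0_l. exact Hq. }
    unfold dRe at 1; cbn [fst RtoD]. field. repeat split; try lra; apply INR_fact_neq_0. }
  rewrite E in H.
  assert (Hden : 0 < (p + INR n) * binc p n) by (apply Rmult_lt_0_compat; lra).
  assert (H' : Rpower (INR (S n)) (p - 1) * INR (S n) <= C * ((p + INR n) * binc p n)).
  { apply Rmult_le_compat_r with (r := (p + INR n) * binc p n) in H; [|lra].
    replace (Rpower (INR (S n)) (p - 1) * (INR (S n) / ((p + INR n) * binc p n))
       * ((p + INR n) * binc p n)) with (Rpower (INR (S n)) (p - 1) * INR (S n)) in H
      by (field; split; lra). exact H. }
  apply Rmult_le_reg_r with (INR (S n)); [easy|]. apply (Rle_trans _ _ _ H').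
  apply Rle_trans with (Rabs C * ((p + INR n) * binc p n)).
  { apply Rmult_le_compat_r; [lra|apply Rle_abs]. }
  assert (p + INR n <= (p + 1) * INR (S n)) by (rewrite S_INR; nra).
  assert (Rabs C * ((p + INR n) * binc p n) <= Rabs C * (((p + 1) * INR (S n)) * binc p n)).
  { apply Rmult_le_compat_l; [apply Rabs_pos|]. apply Rmult_le_compat_r; lra. }
  assert (0 < binc p n * INR (S n)) by (now apply Rmult_lt_0_compat). lra.
Qed.

Lemma ex_series_binc p s : 0 < p -> 0 <= s < 1 -> ex_series (fun k => binc p k * s ^ k).
Proof.
  intros Hp Hs. apply ex_pseries_R, CV_radius_inside.
  rewrite CV_radius_binc, Rabs_pos_eq by lra. cbn. lra.
Qed.

Lemma null_seq_le_geom (e : nat -> R) eps :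
  0 < eps -> filterlim e eventually (locally 0) ->
  exists A, 0 <= A /\ forall k, e k <= eps + A * (1 / 2) ^ k.
Proof.
  intros Heps He.
  destruct (filterlim_bounded (V := R_NormedModule) e) as [M HM]; [now exists 0|].
  destruct (He _ (locally_ball 0 (mkposreal eps Heps))) as [N HN].
  assert (HM0 : 0 <= M) by exact (Rle_trans _ _ _ (Rabs_pos _) (HM 0%nat)).
  pose proof (pow_lt 2 N ltac:(lra)) as H2N.
  exists (M * 2 ^ N). split; [apply Rmult_le_pos; lra|]. intros k.
  assert (Hpow : 0 < (1 / 2) ^ k) by (apply pow_lt; lra).
  destruct (Nat.le_gt_cases N k) as [L|L].
  - specialize (HN k L). apply Rabs_lt_between' in HN; cbn in HN.
    pose proof (Rmult_le_pos (M * 2 ^ N) _ (Rmult_le_pos _ _ HM0 (Rlt_le _ _ H2N)) (Rlt_le _ _ Hpow)).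
    lra.
  - assert (Hk : e k <= M) by exact (Rle_trans _ _ _ (Rle_abs _) (HM k)).
    assert (H1 : 1 <= 2 ^ N * (1 / 2) ^ k).
    { replace N with ((N - k) + k)%nat by lia. rewrite pow_add, Rmult_assoc, <- Rpow_mult_distr.
      replace (2 * (1 / 2)) with 1 by field. rewrite pow1, Rmult_1_r. apply pow_R1_Rle. lra. }
    nra.
Qed.

(** Abel summation with a null sequence of weights: the part of the weights
    exceeding [eps] is absorbed by [A / 2^k], whose contribution stays bounded
    as [s] tends to 1. *)
Lemma abel_null p (e : nat -> R) :
  0 < p -> (forall k, 0 <= e k) -> filterlim e eventually (locally 0) ->
  filterlim (fun s => Rpower (1 - s) p * Series (fun k => e k * (binc p k * s ^ k)))
    (at_left 1) (locally 0).
Proof.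
  intros Hp He0 He Q [eps HQ].
  destruct (null_seq_le_geom e (eps / 2) (is_pos_div_2 eps) He) as (A & HA & Hle).
  set (B := A * Rpower 2 p).
  assert (Hlim : filterlim (fun s => B * Rpower (1 - s) p) (at_left 1) (locally 0)).
  { replace (locally 0) with (locally (B * 0)) by (f_equal; ring).
    apply (filterlim_Rmult_2 (fun _ => B)); [apply filterlim_const|].
    exact (filterlim_comp _ _ _ _ _ _ _ _ filterlim_flip_1 (filterlim_Rpower_0 p Hp)). }
  specialize (Hlim _ (locally_ball 0 (mkposreal _ (is_pos_div_2 eps)))).
  unfold filtermap in *.
  refine (filter_imp _ _ _ (filter_and _ _ Hlim (at_left_Ioo 0 1 Rlt_0_1))).
  intros s [Hb [Hs1 Hs2]]. cbn in Hs1, Hs2. apply HQ. clear Hlim HQ.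
  apply Rabs_lt_between' in Hb; cbn in Hb.
  assert (Hr : 0 < Rpower (1 - s) p) by apply exp_pos.
  assert (Hq : forall k, 0 <= binc p k) by (intros k; left; now apply binc_pos).
  assert (Hsk : forall k, 0 <= s ^ k) by (intros k; apply pow_le; lra).
  assert (Hex1 : ex_series (fun k => eps / 2 * (binc p k * s ^ k))).
  { apply (ex_series_scal (V := R_NormedModule) (eps / 2)). apply ex_series_binc; lra. }
  assert (Hex2 : ex_series (fun k => A * (binc p k * (s / 2) ^ k))).
  { apply (ex_series_scal (V := R_NormedModule) A). apply ex_series_binc; lra. }
  assert (Hterm : forall k, 0 <= e k * (binc p k * s ^ k)
      <= eps / 2 * (binc p k * s ^ k) + A * (binc p k * (s / 2) ^ k)).
  { intros k. pose proof (Rmult_le_pos _ _ (Hq k) (Hsk k)) as H0. split.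
    - now apply Rmult_le_pos.
    - replace ((s / 2) ^ k) with (s ^ k * (1 / 2) ^ k) by (rewrite <- Rpow_mult_distr; f_equal; field).
      specialize (Hle k). nra. }
  assert (Hs : Series (fun k => e k * (binc p k * s ^ k))
      <= eps / 2 * PSeries (binc p) s + A * PSeries (binc p) (s / 2)).
  { unfold PSeries. rewrite <- !Series_scal_l, <- Series_plus by easy.
    apply Series_le; [easy|].
    now apply (ex_series_plus (V := R_NormedModule)). }
  assert (Hs0 : 0 <= Series (fun k => e k * (binc p k * s ^ k))).
  { set (f := fun k => e k * (binc p k * s ^ k)) in *.
    replace 0 with (0 * Series f) by ring. rewrite <- Series_scal_l. apply Series_le.
    - intros k. rewrite Rmult_0_l. split; [lra|]. apply Hterm.
    - apply (ex_series_le (V := R_CompleteNormedModule)) with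
        (fun k => eps / 2 * (binc p k * s ^ k) + A * (binc p k * (s / 2) ^ k)).
      + intros k. change norm with Rabs. rewrite Rabs_pos_eq; apply Hterm.
      + now apply (ex_series_plus (V := R_NormedModule)). }
  pose proof (PSeries_binc p s Hp ltac:(lra)) as E1.
  pose proof (PSeries_binc p (s / 2) Hp ltac:(lra)) as E2.
  assert (Hhalf : PSeries (binc p) (s / 2) <= Rpower 2 p).
  { assert (Hm : / Rpower 2 p <= Rpower (1 - s / 2) p).
    { rewrite <- Rpower_Ropp. unfold Rpower. apply exp_le_mono.
      assert (- ln 2 <= ln (1 - s / 2)); [|nra].
      rewrite <- ln_Rinv by lra. apply ln_le; lra. }
    assert (H2 : 0 < Rpower 2 p) by apply exp_pos.
    assert (Hm0 : 0 < Rpower (1 - s / 2) p) by apply exp_pos.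
    assert (Hinv : / Rpower 2 p * Rpower 2 p = 1) by (apply Rinv_l; lra).
    apply Rmult_le_reg_l with (Rpower (1 - s / 2) p); [easy|]. rewrite E2. nra. }
  apply Rabs_lt_between'. cbn. split; [nra|].
  assert (Rpower (1 - s) p * Series (fun k => e k * (binc p k * s ^ k))
     <= eps / 2 + B * Rpower (1 - s) p); [|lra].
  apply Rle_trans with (Rpower (1 - s) p * (eps / 2 * PSeries (binc p) s + A * PSeries (binc p) (s / 2))).
  { apply Rmult_le_compat_l; lra. }
  replace (Rpower (1 - s) p * (eps / 2 * PSeries (binc p) s + A * PSeries (binc p) (s / 2)))
    with (eps / 2 * (Rpower (1 - s) p * PSeries (binc p) s) +
      Rpower (1 - s) p * (A * PSeries (binc p) (s / 2))) by ring.
  rewrite E1. unfold B. assert (A * PSeries (binc p) (s / 2) <= A * Rpower 2 p) by nra. nra.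
Qed.

(** * Dual power series *)

Definition is_dser (f : nat -> dual) (l : dual) : Prop :=
  is_series (fun k => dRe (f k)) (dRe l) /\ is_series (fun k => dDu (f k)) (dDu l).

Lemma is_Rseries_ext (f g : nat -> R) (l : R) :
  (forall k, f k = g k) -> is_series f l -> is_series g l.
Proof. apply (is_series_ext (V := R_NormedModule)). Qed.

Lemma is_dser_add f g l m :
  is_dser f l -> is_dser g m -> is_dser (fun k => f k + g k)%D (l + m)%D.
Proof. intros [H1 H2] [H3 H4]; split; now apply (is_series_plus (V := R_NormedModule)). Qed.

Lemma is_dser_scal c f l : is_dser f l -> is_dser (fun k => c * f k)%D (c * l)%D.
Proof.
  intros [H1 H2]. split; [now apply (is_series_scal (V := R_NormedModule))|].
  apply (is_series_plus (V := R_NormedModule)); [now apply (is_series_scal (V := R_NormedModule))|].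
  apply is_Rseries_ext with (fun k => dRe (f k) * dDu c).
  { intros k. apply Rmult_comm. }
  rewrite (Rmult_comm (dDu c)). now apply (is_series_scal_r (dDu c)).
Qed.

Lemma is_dser_sub f g l m :
  is_dser f l -> is_dser g m -> is_dser (fun k => f k - g k)%D (l - m)%D.
Proof.
  intros Hf Hg. replace (l - m)%D with (l + RtoD (Ropp 1) * m)%D by (rewrite RtoD_opp; ring).
  assert (E : forall k, (f k + RtoD (Ropp 1) * g k)%D = (f k - g k)%D)
    by (intros; rewrite RtoD_opp; ring).
  destruct (is_dser_add _ _ _ _ Hf (is_dser_scal (RtoD (Ropp 1)) _ _ Hg)) as [H1 H2].
  split; [apply is_Rseries_ext with (2 := H1)|apply is_Rseries_ext with (2 := H2)];
    intros k; now rewrite E.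
Qed.

Lemma is_dser_ext f g l : (forall k, f k = g k) -> is_dser f l -> is_dser g l.
Proof.
  intros E [H1 H2].
  split; [apply is_Rseries_ext with (2 := H1)|apply is_Rseries_ext with (2 := H2)];
    intros k; now rewrite E.
Qed.

Lemma is_dser_tail f l : is_dser f l -> is_dser (fun k => f (S k)) (l - f 0%nat)%D.
Proof.
  intros [H1 H2]; split.
  - apply (is_series_incr_1 (V := R_NormedModule) (fun k => dRe (f k))).
    refine (eq_ind _ (is_series _) H1 _ _). unfold plus, dsub, dadd, dopp, dRe; cbn. ring.
  - apply (is_series_incr_1 (V := R_NormedModule) (fun k => dDu (f k))).
    refine (eq_ind _ (is_series _) H2 _ _). unfold plus, dsub, dadd, dopp, dDu; cbn. ring.
Qed.

Lemma is_dser_cons f l : is_dser (fun k => f (S k)) l -> is_dser f (f 0%nat + l)%D.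
Proof.
  intros [H1 H2]; split.
  - apply (is_series_decr_1 (V := R_NormedModule) (fun k => dRe (f k))).
    refine (eq_ind _ (is_series _) H1 _ _). unfold plus, opp, dadd, dRe; cbn. ring.
  - apply (is_series_decr_1 (V := R_NormedModule) (fun k => dDu (f k))).
    refine (eq_ind _ (is_series _) H2 _ _). unfold plus, opp, dadd, dDu; cbn. ring.
Qed.

Lemma is_dser_unique f l :
  is_dser f l -> (Series (fun k => dRe (f k)), Series (fun k => dDu (f k))) = l.
Proof.
  intros [H1 H2]. apply dual_ext; cbn; [exact (is_series_unique _ _ H1)|exact (is_series_unique _ _ H2)].
Qed.

Lemma is_dser_dominated f (g : nat -> R) :
  (forall k, dabs (f k) <= g k) -> ex_series g ->
  exists l, is_dser f l /\ dabs l <= 2 * Series g.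
Proof.
  intros Hle Hg.
  assert (Hr : forall h : nat -> R, (forall k, Rabs (h k) <= g k) ->
             is_series h (Series h) /\ Rabs (Series h) <= Series g).
  { intros h Hh.
    assert (Habs : ex_series (fun k => Rabs (h k))).
    { apply (ex_series_le (V := R_CompleteNormedModule)) with g; [|easy].
      intros k. change norm with Rabs. now rewrite Rabs_Rabsolu. }
    split; [now apply Series_correct, ex_series_Rabs|].
    apply (Rle_trans _ _ _ (Series_Rabs _ Habs)). apply Series_le; [|easy].
    intros k. split; [apply Rabs_pos|easy]. }
  destruct (Hr (fun k => dRe (f k))) as [S1 B1].
  { intros k. exact (Rle_trans _ _ _ (dabs_Re _) (Hle k)). }
  destruct (Hr (fun k => dDu (f k))) as [S2 B2].
  { intros k. exact (Rle_trans _ _ _ (dabs_Du _) (Hle k)). }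
  eexists (_, _). split; [split; [exact S1|exact S2]|].
  unfold dabs, dRe, dDu; cbn [fst snd]. unfold dRe, dDu in *. lra.
Qed.

Definition dPS (a : nat -> dual) (s : R) : dual :=
  (PSeries (fun k => dRe (a k)) s, PSeries (fun k => dDu (a k)) s).

Definition dPS_derive (a : nat -> dual) (k : nat) : dual := (RtoD (INR (S k)) * a (S k))%D.

Lemma dPS_unique a s l : is_dser (fun k => RtoD (s ^ k) * a k)%D l -> dPS a s = l.
Proof.
  intros H. rewrite <- (is_dser_unique _ _ H). unfold dPS, PSeries.
  f_equal; apply Series_ext; intros k; rewrite dmul_RtoD; unfold dRe, dDu; cbn [fst snd]; ring.
Qed.

Lemma CV_radius_ge_1 (a : nat -> R) :
  (forall s, 0 < s < 1 -> ex_series (fun k => a k * s ^ k)) ->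
  forall x, Rabs x < 1 -> Rbar_lt (Rabs x) (CV_radius a).
Proof.
  intros H x Hx. set (r := (Rabs x + 1) / 2). pose proof (Rabs_pos x).
  apply Rbar_lt_le_trans with r; [cbn; unfold r; lra|].
  apply Rbar_not_lt_le. intros Hlt.
  apply (CV_disk_outside a r).
  - rewrite Rabs_pos_eq by (unfold r; lra). exact Hlt.
  - apply ex_series_lim_0, H. unfold r. lra.
Qed.

Section Analytic.
Context (a : nat -> dual).
Hypothesis Hconv : forall s, 0 < s < 1 -> exists l, is_dser (fun k => RtoD (s ^ k) * a k)%D l.

Lemma CV_radius_dPS x : Rabs x < 1 ->
  Rbar_lt (Rabs x) (CV_radius (fun k => dRe (a k))) /\
  Rbar_lt (Rabs x) (CV_radius (fun k => dDu (a k))).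
Proof.
  intros Hx.
  split; (apply CV_radius_ge_1; [|easy]); intros s Hs; destruct (Hconv s Hs) as [l [H1 H2]].
  - exists (dRe l). apply is_Rseries_ext with (2 := H1).
    intros k. rewrite dmul_RtoD. unfold dRe; cbn [fst]. ring.
  - exists (dDu l). apply is_Rseries_ext with (2 := H2).
    intros k. rewrite dmul_RtoD. unfold dDu; cbn [snd]. ring.
Qed.

Lemma is_dser_dPS x : Rabs x < 1 -> is_dser (fun k => RtoD (x ^ k) * a k)%D (dPS a x).
Proof.
  intros Hx. destruct (CV_radius_dPS x Hx) as [H1 H2]. split.
  - apply is_Rseries_ext with (fun k => dRe (a k) * x ^ k).
    { intros k. rewrite dmul_RtoD. unfold dRe; cbn [fst]. ring. }
    exact (Series_correct _ (proj1 (ex_pseries_R (fun k => dRe (a k)) x) (CV_radius_inside _ _ H1))).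
  - apply is_Rseries_ext with (fun k => dDu (a k) * x ^ k).
    { intros k. rewrite dmul_RtoD. unfold dDu; cbn [snd]. ring. }
    exact (Series_correct _ (proj1 (ex_pseries_R (fun k => dDu (a k)) x) (CV_radius_inside _ _ H2))).
Qed.

Lemma dderive_dPS x : Rabs x < 1 -> dderive (dPS a) x (dPS (dPS_derive a) x).
Proof.
  intros Hx. destruct (CV_radius_dPS x Hx) as [H1 H2]. split.
  - replace (dRe (dPS (dPS_derive a) x)) with (PSeries (PS_derive (fun k => dRe (a k))) x).
    + now apply (is_derive_PSeries (fun k => dRe (a k))).
    + apply PSeries_ext. intros n. unfold dPS_derive. now rewrite dmul_RtoD.
  - replace (dDu (dPS (dPS_derive a) x)) with (PSeries (PS_derive (fun k => dDu (a k))) x).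
    + now apply (is_derive_PSeries (fun k => dDu (a k))).
    + apply PSeries_ext. intros n. unfold dPS_derive. now rewrite dmul_RtoD.
Qed.

Lemma is_dser_dPS_derive x :
  Rabs x < 1 -> is_dser (fun k => RtoD (x ^ k) * dPS_derive a k)%D (dPS (dPS_derive a) x).
Proof.
  intros Hx. destruct (CV_radius_dPS x Hx) as [H1 H2].
  rewrite <- CV_radius_derive in H1, H2.
  assert (K1 := proj1 (ex_pseries_R (PS_derive (fun k => dRe (a k))) x) (CV_radius_inside _ _ H1)).
  assert (K2 := proj1 (ex_pseries_R (PS_derive (fun k => dDu (a k))) x) (CV_radius_inside _ _ H2)).
  split.
  - apply is_Rseries_ext with (fun k => dRe (dPS_derive a k) * x ^ k).
    { intros k. rewrite dmul_RtoD. unfold dRe; cbn [fst]. ring. }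
    apply Series_correct. apply (ex_series_ext (V := R_NormedModule)) with (2 := K1).
    intros k. unfold dPS_derive. now rewrite dmul_RtoD.
  - apply is_Rseries_ext with (fun k => dDu (dPS_derive a k) * x ^ k).
    { intros k. rewrite dmul_RtoD. unfold dDu; cbn [snd]. ring. }
    apply Series_correct. apply (ex_series_ext (V := R_NormedModule)) with (2 := K2).
    intros k. unfold dPS_derive. now rewrite dmul_RtoD.
Qed.

Lemma is_dser_euler x :
  Rabs x < 1 ->
  is_dser (fun k => RtoD (x ^ k) * (RtoD (INR k) * a k))%D (RtoD x * dPS (dPS_derive a) x)%D.
Proof.
  intros Hx.
  assert (H := is_dser_cons (fun k => RtoD (x ^ k) * (RtoD (INR k) * a k))%D (RtoD x * dPS (dPS_derive a) x)%D).
  cbv beta in H. replace (RtoD x * dPS (dPS_derive a) x)%D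
    with (RtoD (x ^ 0) * (RtoD (INR 0) * a 0%nat) + RtoD x * dPS (dPS_derive a) x)%D
    by (cbn [INR]; ring).
  apply H. apply is_dser_ext with (fun k => RtoD x * (RtoD (x ^ k) * dPS_derive a k))%D.
  - intros k. unfold dPS_derive. rewrite <- tech_pow_Rmult, RtoD_mul. ring.
  - apply is_dser_scal. now apply is_dser_dPS_derive.
Qed.
End Analytic.

(** * The primitive of the kernel *)

(** [T] stands for the terms of a series with the parameters [a] over [a + c],
    [inner_coef] for those of the series without them. *)
Section Kernel.
Context (a c : dual) (T : nat -> dual) (S0 v : dual).
Hypothesis (Ha : 0 < dRe a) (Hc : 0 < dRe c).
Hypothesis HT : is_dser T S0.
Hypothesis Hv : is_dbeta a c v.

Definition poch_ratio (k : nat) : dual := (dpoch (a + c) k / dpoch a k)%D.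
Definition inner_coef (k : nat) : dual := (T k * poch_ratio k)%D.

Fixpoint tail (k : nat) : dual :=
  match k with O => S0 | S j => (tail j - T j)%D end.

(** Chosen so that [(a + k) phi_k] and [(a + c + k) phi_k] are [tail (k + 1)]
    times two consecutive ratios; the first-order operator of [inner_series] then
    telescopes. *)
Definition phi (k : nat) : dual := (tail (S k) * poch_ratio k / (a + RtoD (INR k)))%D.

Lemma dRe_b_pos : 0 < dRe (a + c)%D.
Proof. cbn. unfold dRe in *. lra. Qed.

Lemma dpoch_a_neq_0 k : dRe (dpoch a k) <> 0.
Proof. now apply dRe_dpoch_neq_0, dRe_pos_not_pole. Qed.

Lemma shift_a_neq_0 k : dRe (a + RtoD (INR k))%D <> 0.
Proof. apply Rgt_not_eq. now apply dRe_shift_pos. Qed.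

Lemma poch_ratio_S k : ((a + RtoD (INR k)) * poch_ratio (S k))%D = (poch_ratio k * (a + c + RtoD (INR k)))%D.
Proof.
  apply (dmul_cancel_l (dpoch a k)); [apply dpoch_a_neq_0|].
  transitivity (dpoch a (S k) * poch_ratio (S k))%D; [rewrite dpoch_S; ring|].
  unfold poch_ratio. rewrite dmul_div by apply dpoch_a_neq_0. rewrite dpoch_S.
  rewrite <- (dmul_div (dpoch (a + c) k) (dpoch a k)) at 1 by apply dpoch_a_neq_0. ring.
Qed.

Lemma phi_mul_a k : ((a + RtoD (INR k)) * phi k)%D = (tail (S k) * poch_ratio k)%D.
Proof. unfold phi. apply dmul_div, shift_a_neq_0. Qed.

Lemma phi_mul_b k : ((a + c + RtoD (INR k)) * phi k)%D = (tail (S k) * poch_ratio (S k))%D.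
Proof.
  apply (dmul_cancel_l (a + RtoD (INR k))); [apply shift_a_neq_0|].
  transitivity ((a + c + RtoD (INR k)) * ((a + RtoD (INR k)) * phi k))%D; [ring|].
  rewrite phi_mul_a.
  transitivity (tail (S k) * ((a + RtoD (INR k)) * poch_ratio (S k)))%D; [|ring].
  rewrite poch_ratio_S. ring.
Qed.

Lemma dlim_tail : dlim eventually tail (RtoD 0).
Proof.
  assert (E : forall n, tail (S n)
      = (S0 - (sum_n (fun k => dRe (T k)) n, sum_n (fun k => dDu (T k)) n))%D).
  { intros n. induction n as [|n IH].
    - cbn [tail]. rewrite !sum_O. now destruct (T 0%nat).
    - change (tail (S (S n))) with (tail (S n) - T (S n))%D. rewrite IH, !sum_Sn.
      apply dual_ext; unfold plus; cbn; unfold dRe, dDu; ring. }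
  destruct HT as [H1 H2].
  assert (H : dlim eventually (fun n => tail (S n)) (RtoD 0)).
  { apply dlim_ext_loc with
      (fun n => S0 - (sum_n (fun k => dRe (T k)) n, sum_n (fun k => dDu (T k)) n))%D.
    - apply filter_forall. intros n. now rewrite E.
    - replace (RtoD 0) with (S0 - S0)%D by ring.
      apply dlim_sub; [apply dlim_const|]. split; assumption. }
  destruct H as [K1 K2]. split.
  - apply (is_lim_seq_incr_1 (fun n => dRe (tail n)) 0). exact K1.
  - apply (is_lim_seq_incr_1 (fun n => dDu (tail n)) 0). exact K2.
Qed.

Lemma poch_ratio_bounded : exists K, 0 <= K /\ forall k, dabs (Rdpower (INR (S k)) (- c) * poch_ratio k) <= K.
Proof.
  assert (Hpos : forall z k, 0 < dRe z -> 0 < dRe (dpoch z k)).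
  { intros z k Hz. induction k as [|k IH]; [exact Rlt_0_1|]. rewrite dpoch_S, dRe_mul.
    apply Rmult_lt_0_compat; [easy|]. now apply dRe_shift_pos. }
  assert (Hl : dRe (dGamma (a + c) / dGamma a)%D <> 0).
  { apply Rgt_not_eq. unfold ddiv. rewrite dRe_mul.
    apply Rmult_lt_0_compat; [|apply dRe_dinv_pos]; apply dRe_dGamma_pos; [apply dRe_b_pos|easy]. }
  destruct (dlim_seq_bounded _ _ (dlim_inv _ _ Hl (dlim_dpoch_ratio a c Ha Hc))) as [K HK].
  exists K. split; [exact (Rle_trans _ _ _ (dabs_pos _) (HK 0%nat))|].
  intros k. replace (Rdpower (INR (S k)) (- c) * poch_ratio k)%D with
    (dinv (Rdpower (INR (S k)) c * (dpoch a k / dpoch (a + c) k))); [apply HK|].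
  set (X := (Rdpower (INR (S k)) c * (dpoch a k / dpoch (a + c) k))%D).
  assert (HX : dRe X <> 0).
  { apply Rgt_not_eq. unfold X, ddiv. rewrite !dRe_mul.
    apply Rmult_lt_0_compat; [apply dRe_Rdpower_pos|].
    apply Rmult_lt_0_compat; [|apply dRe_dinv_pos]; apply Hpos; [easy|apply dRe_b_pos]. }
  apply (dmul_cancel_l X); [easy|]. rewrite dinv_r by easy. unfold X, poch_ratio.
  symmetry.
  transitivity ((Rdpower (INR (S k)) c * Rdpower (INR (S k)) (- c)) *
     ((dpoch a k * dinv (dpoch a k)) * (dpoch (a + c) k * dinv (dpoch (a + c) k))))%D;
    [unfold ddiv; ring|].
  rewrite Rdpower_opp, !dinv_r; [ring| |]; apply Rgt_not_eq, Hpos; [apply dRe_b_pos|easy].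
Qed.

Let p1 := dRe c + dRe c / 2.
Let p2 := dRe c - dRe c / 2.

(** The term of index [k] is homogeneous in [(k + 1) (1 - s)] up to the factor
    [1/(k + 1)] from [1/(a + k)]. *)
Lemma phi_bound : exists K, 0 < K /\ forall k s, 0 < s < 1 ->
  dabs (Rdpower (1 - s) c * phi k) <=
    K * dabs (tail (S k)) * (Rpower (1 - s) p1 * binc p1 k + Rpower (1 - s) p2 * binc p2 k).
Proof.
  assert (Hp1 : 0 < p1) by (unfold p1; lra). assert (Hp2 : 0 < p2) by (unfold p2; lra).
  destruct poch_ratio_bounded as (K1 & HK1 & B1).
  destruct (dabs_dinv_shift a Ha) as (K2 & HK2 & B2).
  destruct (Rpower_le_binc p1 Hp1) as (L1 & HL1 & C1).
  destruct (Rpower_le_binc p2 Hp2) as (L2 & HL2 & C2).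
  assert (Hc2 : 0 < dRe c / 2) by lra.
  set (M := 1 + Rabs (dDu c) / (dRe c / 2)).
  assert (HM : 0 < M).
  { unfold M. pose proof (Rdiv_le_0_compat _ _ (Rabs_pos (dDu c)) Hc2). lra. }
  exists (M * (K1 + 1) * K2 * (L1 + L2)). split.
  { repeat apply Rmult_lt_0_compat; lra. }
  intros k s Hs. set (n := INR (S k)).
  assert (Hn : 0 < n) by (unfold n; rewrite S_INR; pose proof (pos_INR k); lra).
  set (e := dabs (tail (S k))). assert (He : 0 <= e) by apply dabs_pos.
  assert (Efac : (Rdpower (1 - s) c * phi k)%D =
     (Rdpower (n * (1 - s)) c * (Rdpower n (- c) * poch_ratio k) * (tail (S k) * dinv (a + RtoD (INR k))))%D).
  { rewrite Rdpower_mult by lra. unfold phi, ddiv.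
    transitivity ((Rdpower n c * Rdpower n (- c)) * Rdpower (1 - s) c * poch_ratio k * tail (S k)
       * dinv (a + RtoD (INR k)))%D; [rewrite Rdpower_opp|]; ring. }
  rewrite Efac.
  set (y1 := Rpower (1 - s) p1). set (y2 := Rpower (1 - s) p2).
  assert (Hy1 : 0 < y1) by apply exp_pos. assert (Hy2 : 0 < y2) by apply exp_pos.
  pose proof (binc_pos p1 k Hp1) as Hb1. pose proof (binc_pos p2 k Hp2) as Hb2.
  assert (A1 : dabs (Rdpower (n * (1 - s)) c) <= M * n * ((L1 + L2) * (y1 * binc p1 k + y2 * binc p2 k))).
  { apply (Rle_trans _ _ _ (dabs_Rdpower_le _ c _ Hc2)). fold M. fold p1 p2.
    rewrite <- !Rpower_mult_distr by lra. fold y1 y2.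
    assert (D1 : forall p, Rpower n p = n * Rpower n (p - 1)).
    { intros p. rewrite <- (Rpower_1 n) at 2 by easy. rewrite <- Rpower_plus. f_equal. ring. }
    rewrite (D1 p1), (D1 p2). specialize (C1 k). specialize (C2 k). fold n in C1, C2.
    rewrite (Rmult_assoc M n). apply Rmult_le_compat_l; [lra|].
    replace (n * Rpower n (p1 - 1) * y1 + n * Rpower n (p2 - 1) * y2)
      with (n * (Rpower n (p1 - 1) * y1 + Rpower n (p2 - 1) * y2)) by ring.
    apply Rmult_le_compat_l; [lra|].
    assert (Rpower n (p1 - 1) * y1 <= (L1 + L2) * (y1 * binc p1 k)).
    { apply Rle_trans with (L1 * binc p1 k * y1); [apply Rmult_le_compat_r; lra|].
      pose proof (Rmult_lt_0_compat _ _ Hy1 Hb1). nra. }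
    assert (Rpower n (p2 - 1) * y2 <= (L1 + L2) * (y2 * binc p2 k)).
    { apply Rle_trans with (L2 * binc p2 k * y2); [apply Rmult_le_compat_r; lra|].
      pose proof (Rmult_lt_0_compat _ _ Hy2 Hb2). nra. }
    lra. }
  assert (A2 : dabs (Rdpower n (- c) * poch_ratio k) <= K1 + 1) by (specialize (B1 k); fold n in B1; lra).
  assert (A3 : dabs (tail (S k) * dinv (a + RtoD (INR k))) <= e * (K2 / n)).
  { apply (Rle_trans _ _ _ (dabs_mul _ _)). apply Rmult_le_compat_l; [easy|]. apply B2. }
  set (Y := y1 * binc p1 k + y2 * binc p2 k) in *.
  replace (M * (K1 + 1) * K2 * (L1 + L2) * e * Y)
    with ((M * n * ((L1 + L2) * Y)) * (K1 + 1) * (e * (K2 / n))) by (field; lra).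
  apply (Rle_trans _ _ _ (dabs_mul _ _)).
  apply Rmult_le_compat; [apply dabs_pos|apply dabs_pos| |exact A3].
  apply (Rle_trans _ _ _ (dabs_mul _ _)).
  apply Rmult_le_compat; [apply dabs_pos|apply dabs_pos|exact A1|exact A2].
Qed.

Let e (k : nat) : R := dabs (tail (S k)).

Lemma filterlim_e : filterlim e eventually (locally 0).
Proof.
  pose proof (dlim_dabs _ _ dlim_tail) as H. rewrite dabs_RtoD, Rabs_R0 in H.
  now apply (is_lim_seq_incr_1 (fun k => dabs (tail k)) 0).
Qed.

Lemma ex_series_e_binc p s : 0 < p -> 0 <= s < 1 -> ex_series (fun k => e k * (binc p k * s ^ k)).
Proof.
  intros Hp Hs. destruct (dlim_seq_bounded _ _ dlim_tail) as [M HM].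
  apply (ex_series_le (V := R_CompleteNormedModule)) with (fun k => M * (binc p k * s ^ k)).
  - intros k. change norm with Rabs. pose proof (binc_pos p k Hp). pose proof (pow_le s k ltac:(lra)).
    pose proof (Rmult_le_pos (binc p k) (s ^ k) ltac:(lra) ltac:(lra)).
    rewrite Rabs_pos_eq by (apply Rmult_le_pos; [apply dabs_pos|easy]).
    apply Rmult_le_compat_r; [easy|apply HM].
  - apply (ex_series_scal (V := R_NormedModule) M). now apply ex_series_binc.
Qed.

Lemma phi_series : exists K, 0 < K /\ forall s, 0 < s < 1 ->
  exists l, is_dser (fun k => RtoD (s ^ k) * (Rdpower (1 - s) c * phi k))%D l /\
    dabs l <= K * (Rpower (1 - s) p1 * Series (fun k => e k * (binc p1 k * s ^ k)) +
                   Rpower (1 - s) p2 * Series (fun k => e k * (binc p2 k * s ^ k))).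
Proof.
  assert (Hp1 : 0 < p1) by (unfold p1; lra). assert (Hp2 : 0 < p2) by (unfold p2; lra).
  destruct phi_bound as (K & HK & HB). exists (2 * K). split; [lra|]. intros s Hs.
  set (y1 := Rpower (1 - s) p1). set (y2 := Rpower (1 - s) p2).
  assert (X1 : ex_series (fun k => K * y1 * (e k * (binc p1 k * s ^ k)))).
  { apply (ex_series_scal (V := R_NormedModule) (K * y1)). apply ex_series_e_binc; lra. }
  assert (X2 : ex_series (fun k => K * y2 * (e k * (binc p2 k * s ^ k)))).
  { apply (ex_series_scal (V := R_NormedModule) (K * y2)). apply ex_series_e_binc; lra. }
  destruct (is_dser_dominated (fun k => RtoD (s ^ k) * (Rdpower (1 - s) c * phi k))%D
    (fun k => K * y1 * (e k * (binc p1 k * s ^ k)) + K * y2 * (e k * (binc p2 k * s ^ k))))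
    as (l & Hl & Bl).
  - intros k. rewrite dabs_mul_RtoD. pose proof (pow_le s k ltac:(lra)) as Hk.
    rewrite Rabs_pos_eq by easy. specialize (HB k s Hs). fold y1 y2 in HB. fold (e k) in HB.
    apply Rmult_le_compat_l with (r := s ^ k) in HB; [|easy]. lra.
  - now apply (ex_series_plus (V := R_NormedModule)).
  - exists l. split; [exact Hl|].
    rewrite Series_plus, !Series_scal_l in Bl by easy. lra.
Qed.

Lemma phi_conv s : 0 < s < 1 -> exists l, is_dser (fun k => RtoD (s ^ k) * phi k)%D l.
Proof.
  intros Hs. destruct phi_series as (K & _ & H). destruct (H s Hs) as (l & Hl & _).
  exists (Rdpower (1 - s) (- c) * l)%D.
  apply is_dser_ext with (2 := is_dser_scal (Rdpower (1 - s) (- c)) _ _ Hl).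
  intros k. transitivity (Rdpower (1 - s) c * Rdpower (1 - s) (- c) * (RtoD (s ^ k) * phi k))%D; [ring|].
  rewrite Rdpower_opp. ring.
Qed.

Lemma dlim_phi_1 : dlim (at_left 1) (fun s => Rdpower (1 - s) c * dPS phi s)%D (RtoD 0).
Proof.
  assert (Hp1 : 0 < p1) by (unfold p1; lra). assert (Hp2 : 0 < p2) by (unfold p2; lra).
  assert (He : forall k, 0 <= e k) by (intros k; apply dabs_pos).
  destruct phi_series as (K & _ & H).
  apply dlim_squeeze with (fun s =>
    K * (Rpower (1 - s) p1 * Series (fun k => e k * (binc p1 k * s ^ k)) +
         Rpower (1 - s) p2 * Series (fun k => e k * (binc p2 k * s ^ k)))).
  - apply filter_imp with (2 := at_left_Ioo 0 1 Rlt_0_1). intros s [Hs1 Hs2]. cbn in Hs1, Hs2.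
    destruct (H s (conj Hs1 Hs2)) as (l & Hl & Bl).
    replace (Rdpower (1 - s) c * dPS phi s - RtoD 0)%D with l; [exact Bl|].
    rewrite <- (is_dser_unique _ _ Hl).
    replace (Rdpower (1 - s) c * dPS phi s - RtoD 0)%D with (Rdpower (1 - s) c * dPS phi s)%D by ring.
    apply is_dser_unique.
    apply is_dser_ext with (fun k => Rdpower (1 - s) c * (RtoD (s ^ k) * phi k))%D; [intros; ring|].
    apply is_dser_scal, (is_dser_dPS phi phi_conv). rewrite Rabs_pos_eq; lra.
  - replace (locally 0) with (locally (K * (0 + 0))) by (f_equal; ring).
    apply (filterlim_Rmult_2 (fun _ => K)); [apply filterlim_const|].
    apply filterlim_Rplus_2; apply abel_null; auto; apply filterlim_e.
Qed.

(** Summation by parts at the level of power series: the coefficient of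
    [s^(k+1)] on the right is [(tail (k+1) - tail (k+2)) * poch_ratio (k+1)]. *)
Lemma inner_series s :
  Rabs s < 1 ->
  is_dser (fun k => RtoD (s ^ k) * inner_coef k)%D
    (S0 - (a - (a + c) * RtoD s) * dPS phi s
        - RtoD s * (RtoD 1 - RtoD s) * dPS (dPS_derive phi) s)%D.
Proof.
  intros Hs.
  pose proof (is_dser_dPS phi phi_conv s Hs) as H0.
  pose proof (is_dser_euler phi phi_conv s Hs) as H1.
  set (Phi := dPS phi s) in *. set (Phi' := dPS (dPS_derive phi) s) in *.
  assert (SA : is_dser (fun k => RtoD (s ^ k) * (tail (S k) * poch_ratio k))%D (a * Phi + RtoD s * Phi')%D).
  { apply is_dser_ext with (2 := is_dser_add _ _ _ _ (is_dser_scal a _ _ H0) H1).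
    intros k. rewrite <- phi_mul_a. ring. }
  assert (SB : is_dser (fun k => RtoD (s ^ S k) * (tail (S k) * poch_ratio (S k)))%D
                 (RtoD s * ((a + c) * Phi + RtoD s * Phi'))%D).
  { apply is_dser_ext with (2 := is_dser_scal (RtoD s) _ _
      (is_dser_add _ _ _ _ (is_dser_scal (a + c)%D _ _ H0) H1)).
    intros k. rewrite <- phi_mul_b, <- tech_pow_Rmult, RtoD_mul. ring. }
  assert (Q0 : poch_ratio 0 = RtoD 1).
  { unfold poch_ratio. cbn [dpoch]. apply ddiv_eq; [exact R1_neq_R0|ring]. }
  pose proof (is_dser_sub _ _ _ _ SB (is_dser_tail _ _ SA)) as HD.
  pose proof (is_dser_cons (fun k => RtoD (s ^ k) * inner_coef k)%D) as Hcons. cbv beta in Hcons.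
  replace (S0 - (a - (a + c) * RtoD s) * Phi - RtoD s * (RtoD 1 - RtoD s) * Phi')%D with
    (RtoD (s ^ 0) * inner_coef 0 + (RtoD s * ((a + c) * Phi + RtoD s * Phi')
       - (a * Phi + RtoD s * Phi' - RtoD (s ^ 0) * (tail 1 * poch_ratio 0))))%D.
  - apply Hcons. apply is_dser_ext with (2 := HD). intros k. unfold inner_coef. cbn [tail]. ring.
  - unfold inner_coef. rewrite Q0. cbn [tail pow]. ring.
Qed.

Lemma inner_conv s : 0 < s < 1 -> exists l, is_dser (fun k => RtoD (s ^ k) * inner_coef k)%D l.
Proof. intros Hs. eexists. apply inner_series. rewrite Rabs_pos_eq; lra. Qed.

Lemma kernel_primitive : exists P,
  dprimitive 0 1 (fun u => betaf a c u * dPS inner_coef u)%D P /\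
  dlim (at_right 0) P (RtoD 0) /\ dlim (at_left 1) P (S0 * v)%D.
Proof.
  destruct Hv as (B & HB & B0 & B1).
  exists (fun u => S0 * B u - Rdpower u a * (Rdpower (1 - u) c * dPS phi u))%D.
  split; [|split].
  - intros u Hu1 Hu2. cbn in Hu1, Hu2.
    assert (Hu : Rabs u < 1) by (rewrite Rabs_pos_eq; lra).
    rewrite (dPS_unique _ _ _ (inner_series u Hu)).
    apply dderive_ext with (fun u => S0 * B u - Rdpower u a * Rdpower (1 - u) c * dPS phi u)%D.
    { apply filter_forall. intros t. ring. }
    assert (Hb := dderive_beta_boundary a c u Hu1 Hu2).
    assert (Hd := dderive_sub _ _ _ _ _ (dderive_scal S0 _ _ _ (HB u Hu1 Hu2))
      (dderive_mul _ _ _ _ _ Hb (dderive_dPS phi phi_conv u Hu))).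
    match type of Hd with dderive _ _ ?l =>
      replace (betaf a c u * (S0 - (a - (a + c) * RtoD u) * dPS phi u -
        RtoD u * (RtoD 1 - RtoD u) * dPS (dPS_derive phi) u))%D with l end; [exact Hd|].
    assert (E1 : betaf (a + RtoD 1) c u = (RtoD u * betaf a c u)%D).
    { unfold betaf. replace (a + RtoD 1 - RtoD 1)%D with a by ring.
      rewrite <- (Rdpower_pred u a) by easy. ring. }
    assert (E2 : (Rdpower u a * Rdpower (1 - u) c)%D = (RtoD u * (RtoD 1 - RtoD u) * betaf a c u)%D).
    { unfold betaf. rewrite <- (Rdpower_pred u a), <- (Rdpower_pred (1 - u) c), RtoD_sub by lra. ring. }
    rewrite E1, E2. ring.
  - assert (Hphi0 : dlim (at_right 0) (dPS phi) (dPS phi 0)).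
    { refine (dlim_comp (at_right 0) (locally 0) (fun t => t) (dPS phi) _ (at_right_locally 0) _).
      apply dderive_continuous with (1 := dderive_dPS phi phi_conv 0 ltac:(rewrite Rabs_R0; lra)). }
    replace (RtoD 0) with (S0 * RtoD 0 - RtoD 0 * (RtoD 1 * dPS phi 0))%D by ring.
    apply dlim_sub; [apply dlim_mul; [apply dlim_const|easy]|].
    apply dlim_mul; [now apply dlim_Rdpower_0|].
    apply dlim_mul; [apply dlim_Rdpower_flip_0|easy].
  - replace (S0 * v)%D with (S0 * v - RtoD 1 * RtoD 0)%D by ring.
    apply dlim_sub; [apply dlim_mul; [apply dlim_const|easy]|].
    apply dlim_mul; [apply dlim_Rdpower_left|apply dlim_phi_1].
Qed.
End Kernel.

(** * Hypergeometric series *)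

Lemma is_series_dual (f : nat -> dual) (l : dual) :
  is_series (V := dual_NormedModule) f l <-> is_dser f l.
Proof.
  assert (E : forall n, sum_n (G := dual_NormedModule) f n
      = (sum_n (fun k => dRe (f k)) n, sum_n (fun k => dDu (f k)) n)).
  { intros n. induction n as [|n IH].
    - rewrite !sum_O. apply surjective_pairing.
    - rewrite !sum_Sn, IH. reflexivity. }
  split.
  - intros H. split; intros Q [eps HQ]; unfold filtermap.
    + assert (HL : locally (T := dual_NormedModule) l (fun y => Q (fst y))).
      { exists eps. intros y [Hy _]. now apply HQ. }
      assert (K := H _ HL). unfold filtermap in K. revert K. apply filter_imp. intros n Hn. now rewrite E in Hn.
    + assert (HL : locally (T := dual_NormedModule) l (fun y => Q (snd y))).
      { exists eps. intros y [_ Hy]. now apply HQ. }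
      assert (K := H _ HL). unfold filtermap in K. revert K. apply filter_imp. intros n Hn. now rewrite E in Hn.
  - intros [H1 H2] Q [eps HQ]. unfold filtermap.
    assert (K1 := H1 _ (locally_ball _ eps)). assert (K2 := H2 _ (locally_ball _ eps)).
    unfold filtermap in K1, K2.
    refine (filter_imp _ _ _ (filter_and _ _ K1 K2)). intros n [B1 B2].
    apply HQ. rewrite E. now split.
Qed.

Lemma dinv_mul x y : dRe x <> 0 -> dRe y <> 0 -> dinv (x * y) = (dinv x * dinv y)%D.
Proof.
  intros Hx Hy. apply (dmul_cancel_l (x * y)).
  - rewrite dRe_mul. now apply Rmult_integral_contrapositive_currified.
  - rewrite dinv_r by (rewrite dRe_mul; now apply Rmult_integral_contrapositive_currified).
    transitivity ((x * dinv x) * (y * dinv y))%D; [|ring]. rewrite !dinv_r by easy. ring.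
Qed.

Lemma dpow_scal u x k : dpow (RtoD u * x) k = (RtoD (u ^ k) * dpow x k)%D.
Proof.
  induction k as [|k IH]; cbn [dpow pow]; [ring|]. rewrite IH, RtoD_mul. ring.
Qed.

Lemma dhyp_term_scal a b u x k :
  dhyp_term a b (RtoD u * x) k = (RtoD (u ^ k) * dhyp_term a b x k)%D.
Proof. unfold dhyp_term, ddiv. rewrite dpow_scal. ring. Qed.

Lemma dRe_dpoch_prod_neq_0 b k :
  (forall c, In c b -> forall n, dRe c <> - INR n) -> dRe (dpoch_prod b k) <> 0.
Proof.
  intros Hb. induction b as [|b1 b IH]; [exact R1_neq_R0|].
  unfold dpoch_prod; cbn [fold_right]. fold (dpoch_prod b k). rewrite dRe_mul.
  apply Rmult_integral_contrapositive_currified.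
  - apply dRe_dpoch_neq_0, Hb. now left.
  - apply IH. intros c Hc. apply Hb. now right.
Qed.

Lemma dhyp_term_cons a1 b1 a b x k :
  0 < dRe a1 -> (forall c, In c (b1 :: b) -> forall n, dRe c <> - INR n) ->
  (dhyp_term (a1 :: a) (b1 :: b) x k * (dpoch b1 k / dpoch a1 k))%D = dhyp_term a b x k.
Proof.
  intros Ha Hb.
  assert (H1 : dRe (dpoch a1 k) <> 0) by (now apply dRe_dpoch_neq_0, dRe_pos_not_pole).
  assert (H2 : dRe (dpoch b1 k) <> 0) by (apply dRe_dpoch_neq_0, Hb; now left).
  assert (H3 : dRe (dpoch_prod b k) <> 0).
  { apply dRe_dpoch_prod_neq_0. intros c Hc. apply Hb. now right. }
  unfold dhyp_term, ddiv. unfold dpoch_prod at 1 2; cbn [fold_right].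
  fold (dpoch_prod a k) (dpoch_prod b k).
  rewrite dinv_mul by easy.
  transitivity ((dpoch a1 k * dinv (dpoch a1 k)) * (dpoch b1 k * dinv (dpoch b1 k)) *
    (dpoch_prod a k * dinv (dpoch_prod b k) * (dpow x k * dinv (RtoD (INR (fact k))))))%D; [ring|].
  rewrite !dinv_r by easy. ring.
Qed.

Lemma is_RInt_gen_ext_interval (a b : Rbar) (Fa Fb : (R -> Prop) -> Prop)
    {FFa : Filter Fa} {FFb : Filter Fb} (f g : R -> dual) (l : dual) :
  Fa (fun u : R => Rbar_lt a u /\ Rbar_lt u b) -> Fb (fun u : R => Rbar_lt a u /\ Rbar_lt u b) ->
  (forall u : R, Rbar_lt a u -> Rbar_lt u b -> f u = g u) ->
  is_RInt_gen (V := dual_NormedModule) f Fa Fb l -> is_RInt_gen (V := dual_NormedModule) g Fa Fb l.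
Proof.
  intros Da Db E. apply (is_RInt_gen_ext (V := dual_NormedModule)).
  exists (fun u : R => Rbar_lt a u /\ Rbar_lt u b) (fun u : R => Rbar_lt a u /\ Rbar_lt u b); try easy.
  intros x y [Hx1 Hx2] [Hy1 Hy2] z [Hz1 Hz2]; cbn [fst snd] in *. apply E.
  - apply Rbar_lt_trans with (Rmin x y); [now apply Rmin_case|easy].
  - apply Rbar_lt_trans with (Rmax x y); [easy|now apply Rmax_case].
Qed.

(** * Moebius substitution *)

Definition moeb (beta u : R) : R := beta * u / (1 + beta * u).

Lemma moeb_Ioo beta u : 0 < beta -> 0 < u -> 0 < moeb beta u < 1.
Proof.
  intros Hb Hu. unfold moeb. assert (0 < beta * u) by nra. split.
  - apply Rdiv_lt_0_compat; lra.
  - apply Rlt_div_l; lra.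
Qed.

Lemma is_derive_moeb beta u :
  0 < beta -> 0 < u -> is_derive (moeb beta) u (beta / (1 + beta * u) ^ 2).
Proof.
  intros Hb Hu. assert (0 < beta * u) by nra. unfold moeb. auto_derive; [lra|]. field. lra.
Qed.

Lemma filterlim_moeb_0 beta : 0 < beta -> filterlim (moeb beta) (at_right 0) (at_right 0).
Proof.
  intros Hb Q [eps HQ].
  assert (He : 0 < eps / beta) by (apply Rdiv_lt_0_compat; [apply eps|easy]).
  exists (mkposreal _ He). intros u Hu Hu0.
  apply Rabs_lt_between' in Hu; cbn in Hu. destruct (moeb_Ioo beta u Hb Hu0) as [H1 _].
  apply HQ; [|easy]. apply Rabs_lt_between'.
  assert (moeb beta u <= beta * u) by (unfold moeb; apply Rle_div_l; nra).
  assert (beta * u < eps).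
  { replace (pos eps) with (beta * (eps / beta)) by (field; lra). apply Rmult_lt_compat_l; lra. }
  pose proof (cond_pos eps). lra.
Qed.

Lemma filterlim_moeb_1 beta : 0 < beta -> filterlim (moeb beta) (Rbar_locally p_infty) (at_left 1).
Proof.
  intros Hb Q [eps HQ]. pose proof (cond_pos eps) as He.
  exists (/ (beta * eps)). intros u Hu.
  assert (Hbe : 0 < beta * eps) by nra.
  assert (Hu0 : 0 < u) by (pose proof (Rinv_0_lt_compat _ Hbe); lra).
  destruct (moeb_Ioo beta u Hb Hu0) as [H1 H2]. apply HQ; [|easy]. apply Rabs_lt_between'.
  assert (0 < beta * u) by nra.
  assert (E : 1 - moeb beta u = / (1 + beta * u)) by (unfold moeb; field; lra).
  assert (Hbig : 1 < beta * eps * u).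
  { apply Rmult_lt_compat_l with (r := beta * eps) in Hu; [|easy]. rewrite Rinv_r in Hu by lra. exact Hu. }
  assert (/ (1 + beta * u) < eps); [|lra].
  apply Rmult_lt_reg_r with (1 + beta * u); [lra|]. rewrite Rinv_l by lra. nra.
Qed.

Lemma betaf_moeb a c beta u :
  0 < beta -> 0 < u ->
  (Rdpower u (a - RtoD 1) * Rdpower (1 + beta * u) (- (a + c)))%D =
  (Rdpower beta (- a) * (RtoD (beta / (1 + beta * u) ^ 2) * betaf a c (moeb beta u)))%D.
Proof.
  intros Hb Hu. assert (Hbu : 0 < beta * u) by nra.
  set (w := 1 + beta * u). assert (Hw : 0 < w) by (unfold w; lra).
  pose proof (Rinv_0_lt_compat w Hw) as Hiw.
  assert (Ev : moeb beta u = beta * u * / w) by reflexivity.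
  assert (Ev1 : 1 - moeb beta u = / w) by (unfold moeb, w; field; lra).
  assert (Eh : RtoD (beta / w ^ 2)
     = (Rdpower beta (RtoD 1) * (Rdpower w (- RtoD 1) * Rdpower w (- RtoD 1)))%D).
  { rewrite <- !Rdpower_inv, !Rdpower_1_r, <- !RtoD_mul by easy. f_equal. field. lra. }
  unfold betaf. rewrite Ev1, Ev, Eh, !Rdpower_mult, !Rdpower_inv by nra.
  transitivity ((Rdpower beta (- a) * Rdpower beta (RtoD 1) * Rdpower beta (a - RtoD 1)) *
     (Rdpower u (a - RtoD 1) *
      (Rdpower w (- RtoD 1) * Rdpower w (- RtoD 1) * Rdpower w (- (a - RtoD 1))
        * Rdpower w (- (c - RtoD 1)))))%D; [|ring].
  rewrite <- !Rdpower_add.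
  replace (- a + RtoD 1 + (a - RtoD 1))%D with (a + - a)%D by ring.
  rewrite (Rdpower_add beta), Rdpower_opp.
  replace (- RtoD 1 + - RtoD 1 + - (a - RtoD 1) + - (c - RtoD 1))%D with (- (a + c))%D by ring.
  ring.
Qed.

(* [a1 :: a] and [b1 :: b] are the p >= 1 upper and q >= 1 lower parameters.
   The exponent of 1 + u and of 1 + beta u is - b1: it is what u/(1+u) and
   beta u/(1+beta u) give when substituted for u in the first integral.  The
   exponent - a1 - b1 sometimes printed makes the last two formulas false
   (a1 = 1, b1 = 2, a = b = nil, x = 0 would give 1 = 1/2). *)
Theorem theorem6p2 :
  forall (a1 b1 : dual) (a b : list dual) (x : dual),
    0 < dRe a1 -> 0 < dRe b1 -> 0 < dRe (b1 - a1)%D ->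
    dhyp_defined (a1 :: a) (b1 :: b) x ->
    (forall u : R, 0 < u < 1 -> dhyp_defined a b (RtoD u * x)%D) /\
    (exists I : dual,
       is_dRInt_0_1
         (fun u => Rdpower u (a1 - RtoD 1) * Rdpower (1 - u) (b1 - a1 - RtoD 1)
                   * dhyp a b (RtoD u * x))%D I /\
       dhyp (a1 :: a) (b1 :: b) x
         = (dGamma b1 / (dGamma a1 * dGamma (b1 - a1)) * I)%D) /\
    (exists I : dual,
       is_dRInt_0_infty
         (fun u => Rdpower u (a1 - RtoD 1) * Rdpower (1 + u) (- b1)
                   * dhyp a b (RtoD (u / (1 + u)) * x))%D I /\
       dhyp (a1 :: a) (b1 :: b) x
         = (dGamma b1 / (dGamma a1 * dGamma (b1 - a1)) * I)%D) /\
    (forall beta : R, 0 < beta ->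
     exists I : dual,
       is_dRInt_0_infty
         (fun u => Rdpower u (a1 - RtoD 1) * Rdpower (1 + beta * u) (- b1)
                   * dhyp a b (RtoD (beta * u / (1 + beta * u)) * x))%D I /\
       dhyp (a1 :: a) (b1 :: b) x
         = (dGamma b1 / (dGamma a1 * dGamma (b1 - a1)) * Rdpower beta a1 * I)%D).
Proof.
  intros a1 b1 a b x Ha Hb Hc [Hpole Hser0].
  assert (HS : exists S0 : dual, is_dser (dhyp_term (a1 :: a) (b1 :: b) x) S0).
  { destruct Hser0 as [S0 HS]. exists S0. now apply is_series_dual. }
  destruct HS as [S0 HS].
  set (c := (b1 - a1)%D) in *. assert (Ebc : (a1 + c)%D = b1) by (unfold c; ring).
  destruct (is_dbeta_ex a1 c Ha Hc) as [v Hv].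
  set (T := dhyp_term (a1 :: a) (b1 :: b) x) in *.
  set (D := inner_coef a1 c T).
  assert (ED : forall k, D k = dhyp_term a b x k).
  { intros k. unfold D, inner_coef, poch_ratio. rewrite Ebc. now apply dhyp_term_cons. }
  assert (Hser : forall u, 0 < u < 1 ->
            is_dser (dhyp_term a b (RtoD u * x)) (dPS D u)).
  { intros u Hu. apply is_dser_ext with (fun k => RtoD (u ^ k) * D k)%D.
    - intros k. rewrite ED. symmetry. apply dhyp_term_scal.
    - apply (is_dser_dPS D); [|rewrite Rabs_pos_eq; lra].
      exact (inner_conv a1 c T S0 Ha Hc HS). }
  assert (EF : forall u, 0 < u < 1 -> dhyp a b (RtoD u * x) = dPS D u).
  { intros u Hu. now apply is_dser_unique, Hser. }
  assert (ES : dhyp (a1 :: a) (b1 :: b) x = S0) by now apply is_dser_unique.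
  assert (HG : (dGamma b1 / (dGamma a1 * dGamma c) * v)%D = RtoD 1).
  { rewrite <- (dbeta_dGamma a1 c v Ha Hc Hv), Ebc.
    unfold ddiv. transitivity ((v * dGamma b1) * dinv (v * dGamma b1))%D; [ring|].
    apply dinv_r, Rgt_not_eq. rewrite <- Ebc, (dbeta_dGamma a1 c v Ha Hc Hv), dRe_mul.
    apply Rmult_lt_0_compat; now apply dRe_dGamma_pos. }
  destruct (kernel_primitive a1 c T S0 v Ha Hc HS Hv) as (P & HP & P0 & P1). fold D in HP.
  set (g := fun u => (betaf a1 c u * dPS D u)%D) in *.
  assert (Hg : dderivable 0 1 g).
  { intros u Hu1 Hu2. destruct (dderivable_betaf a1 c u Hu1 Hu2) as [l Hl].
    cbn in Hu1, Hu2. eexists. apply dderive_mul; [exact Hl|].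
    apply (dderive_dPS D); [|rewrite Rabs_pos_eq; lra].
    exact (inner_conv a1 c T S0 Ha Hc HS). }
  assert (Hmoeb : forall beta : R, 0 < beta ->
     exists I : dual,
       is_dRInt_0_infty
         (fun u => Rdpower u (a1 - RtoD 1) * Rdpower (1 + beta * u) (- b1)
                   * dhyp a b (RtoD (beta * u / (1 + beta * u)) * x))%D I /\
       dhyp (a1 :: a) (b1 :: b) x
         = (dGamma b1 / (dGamma a1 * dGamma c) * Rdpower beta a1 * I)%D).
  { intros beta Hbeta. exists (Rdpower beta (- a1) * (S0 * v))%D. split.
    - set (f := fun u => (Rdpower beta (- a1) *
        (RtoD (beta / (1 + beta * u) ^ 2) * g (moeb beta u)))%D).
      apply (is_RInt_gen_ext_interval 0 p_infty (at_right 0) (Rbar_locally p_infty) f _ _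
               (at_right_Ioi 0) (p_infty_Ioi 0)).
      { intros u Hu _. cbn in Hu. fold (moeb beta u).
        rewrite EF by now apply moeb_Ioo. rewrite <- Ebc, betaf_moeb by easy.
        unfold f, g. ring. }
      apply (is_dRInt_primitive 0 p_infty (at_right 0) (Rbar_locally p_infty)
               (at_right_Ioi 0) (p_infty_Ioi 0) f (fun u => Rdpower beta (- a1) * P (moeb beta u))%D).
      + intros u Hu _. cbn in Hu. destruct (moeb_Ioo beta u Hbeta Hu) as [M1 M2].
        apply dderive_scal, dderive_comp; [now apply HP|now apply is_derive_moeb].
      + intros u Hu _. cbn in Hu. destruct (moeb_Ioo beta u Hbeta Hu) as [M1 M2].
        destruct (Hg (moeb beta u) M1 M2) as [l Hl]. assert (0 < beta * u) by nra.
        eexists. apply dderive_scal, dderive_mul.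
        * apply (dderive_RtoD (fun u => beta / (1 + beta * u) ^ 2)).
          apply (Derive_correct (fun u => beta / (1 + beta * u) ^ 2)).
          auto_derive. apply Rgt_not_eq. nra.
        * exact (dderive_comp g (moeb beta) u l _ Hl (is_derive_moeb beta u Hbeta Hu)).
      + replace (RtoD 0) with (Rdpower beta (- a1) * RtoD 0)%D by ring.
        apply dlim_mul; [apply dlim_const|].
        exact (dlim_comp _ _ _ _ _ (filterlim_moeb_0 beta Hbeta) P0).
      + apply dlim_mul; [apply dlim_const|].
        exact (dlim_comp _ _ _ _ _ (filterlim_moeb_1 beta Hbeta) P1).
    - rewrite ES.
      transitivity ((dGamma b1 / (dGamma a1 * dGamma c) * v) *
         (Rdpower beta a1 * Rdpower beta (- a1)) * S0)%D; [|ring].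
      rewrite HG, Rdpower_opp. ring. }
  split; [|split; [|split; [|exact Hmoeb]]].
  - intros u Hu. split.
    + intros d Hd. apply Hpole. now right.
    + exists (dPS D u). apply is_series_dual. now apply Hser.
  - exists (S0 * v)%D. split.
    + apply (is_RInt_gen_ext_interval 0 1 (at_right 0) (at_left 1) g _ _
               (at_right_Ioo 0 1 Rlt_0_1) (at_left_Ioo 0 1 Rlt_0_1)).
      { intros u Hu1 Hu2. cbn in Hu1, Hu2. now rewrite EF. }
      apply (is_dRInt_primitive 0 1 (at_right 0) (at_left 1)
               (at_right_Ioo 0 1 Rlt_0_1) (at_left_Ioo 0 1 Rlt_0_1) g P); assumption.
    + rewrite ES.
      transitivity ((dGamma b1 / (dGamma a1 * dGamma c) * v) * S0)%D; [|ring].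
      rewrite HG. ring.
  - destruct (Hmoeb 1 Rlt_0_1) as (I & HI & EI). exists I. split.
    + apply (is_RInt_gen_ext_interval 0 p_infty (at_right 0) (Rbar_locally p_infty) _ _ _
               (at_right_Ioi 0) (p_infty_Ioi 0)) with (2 := HI).
      intros u _ _. now rewrite Rmult_1_l.
    + rewrite EI, Rdpower_1_l. ring.
Qed.
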